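(* No Schnorr random $A\in\{0,1\}^\omega$ is low for speed. Consequently the set $\mathsf{LFS}$ of low for speed oracles has Lebesgue (uniform) measure $0$ in $\{0,1\}^\omega$.
   Context: Oracles are languages $X\subseteq\{0,1\}^*$, identified with subsets of $\mathbb{N}$ (the $(n+1)$-th string in length-lexicographic order corresponds to $n$) and with infinite binary sequences in $\{0,1\}^\omega$. Oracle computations are measured in the usual complexity-theoretic model: the machine has a query tape, and once a string $x$ is written on it, the answer to ''is $x\in X$?'' is obtained in time $O(1)$. An oracle $X$ is \emph{low for speed} if for every computable (decidable) language $L$: whenever some oracle Turing machine $M$ with oracle $X$ decides $L$ within time bound $f$ (i.e. $time(M^X,x)\le f(x)$ for all inputs $x$), there exist a Turing machine $M'$ without oracle and a polynomial $p$ such that $M'$ decides $L$ within time bound $p\circ f$. $\mathsf{LFS}$ denotes the set of low for speed oracles. *)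

(* Defs.v *)
From HB Require Import structures.
From mathcomp Require Import all_boot all_order all_algebra.
Set Implicit Arguments. Unset Strict Implicit. Unset Printing Implicit Defensive.
Import Order.TTheory GRing.Theory Num.Theory.

(* An oracle X ⊆ {0,1}^* ≅ subset of nat ≅ infinite binary sequence:
   X n = bit n of the sequence = membership of the (n+1)-th string. *)
Definition oracle := nat -> bool.
Definition language := seq bool -> Prop.

Definition bin_val (s : seq bool) : nat := foldl (fun acc (b : bool) => acc.*2 + b) 0 s.
(* index of s in length-lexicographic order (empty string ↦ 0, "0" ↦ 1, "1" ↦ 2, "00" ↦ 3, ...) *)
Definition str_index (s : seq bool) : nat := (bin_val (true :: s)).-1.

Definition empty_oracle : oracle := fun _ => false.

Inductive move := MoveL | MoveR | Stay.
(* action on the (write-only) query tape: nothing, or append a bit *)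
Inductive qact := QNop | QPush of bool.

Record OTM := {
  state : finType;
  symb : finType;
  blank : symb;
  bit0 : symb;
  bit1 : symb;
  q_start : state;
  q_acc : state;
  q_rej : state;
  q_query : state;
  q_yes : state;
  q_no : state;
  trans : state -> symb -> state * symb * move * qact }.
Arguments blank : clear implicits.  Arguments bit0 : clear implicits.
Arguments bit1 : clear implicits.   Arguments q_start : clear implicits.
Arguments q_acc : clear implicits.  Arguments q_rej : clear implicits.
Arguments q_query : clear implicits. Arguments q_yes : clear implicits.
Arguments q_no : clear implicits.   Arguments trans : clear implicits.

Record config (M : OTM) := Config {
  c_state : state M;
  c_left : seq (symb M);   (* cells left of the head, nearest first *)
  c_head : symb M;
  c_right : seq (symb M);  (* cells right of the head, nearest first *)
  c_query : seq bool       (* query tape content, reversed *) }.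

Definition halted (M : OTM) (c : config M) : bool :=
  (c_state c == q_acc M) || (c_state c == q_rej M).

Definition move_tape (M : OTM) (l : seq (symb M)) (h : symb M) (r : seq (symb M)) (m : move)
  : seq (symb M) * symb M * seq (symb M) :=
  match m with
  | Stay => (l, h, r)
  | MoveL => match l with [::] => ([::], blank M, h :: r) | a :: l' => (l', a, h :: r) end
  | MoveR => match r with [::] => (h :: l, blank M, [::]) | a :: r' => (h :: l, a, r') end
  end.

Definition step (M : OTM) (X : oracle) (c : config M) : config M :=
  if halted c then c else
  if c_state c == q_query M then
    Config (if X (str_index (rev (c_query c))) then q_yes M else q_no M)
           (c_left c) (c_head c) (c_right c) [::]
  else
    let: (q', s, m, a) := trans M (c_state c) (c_head c) in
    let: (l', h', r') := move_tape (c_left c) s (c_right c) m in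
    Config q' l' h' r' (match a with QNop => c_query c | QPush b => b :: c_query c end).

Arguments step : clear implicits.

Definition enc_bit (M : OTM) (b : bool) : symb M := if b then bit1 M else bit0 M.

Definition init (M : OTM) (x : seq bool) : config M :=
  match x with
  | [::] => Config (q_start M) [::] (blank M) [::] [::]
  | b :: x' => Config (q_start M) [::] (enc_bit M b) (map (enc_bit M) x') [::]
  end.

Definition run (M : OTM) (X : oracle) (x : seq bool) (t : nat) : config M :=
  iter t (step M X) (init M x).

Definition decides_within (M : OTM) (X : oracle) (L : language) (f : seq bool -> nat) : Prop :=
  forall x, halted (run M X x (f x)) /\ (c_state (run M X x (f x)) = q_acc M <-> L x).

(* Machines without oracle = machines run with the empty oracle
   (queries are then answered "no", a purely constant-time matter). *)
Definition computable (L : language) : Prop :=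
  exists M : OTM, forall x, exists t,
    halted (run M empty_oracle x t) /\ (c_state (run M empty_oracle x t) = q_acc M <-> L x).

Definition peval (p : seq nat) (n : nat) : nat := foldr (fun a acc => a + n * acc) 0 p.

Definition low_for_speed (X : oracle) : Prop :=
  forall (L : language), computable L ->
  forall (M : OTM) (f : seq bool -> nat), decides_within M X L f ->
  exists (M' : OTM) (p : seq nat), decides_within M' empty_oracle L (fun x => peval p (f x)).

(* self-delimiting unary code of a natural number *)
Definition enc_nat (n : nat) : seq bool := rcons (nseq n true) false.
Definition enc_opt (o : option (seq bool)) : seq bool :=
  match o with None => [:: false] | Some s => true :: s end.

(* total g : nat -> nat -> option string is computable iff its graph is decidable *)
Definition computable_fun_opt (g : nat -> nat -> option (seq bool)) : Prop :=
  computable (fun s => exists n i, s = enc_nat n ++ enc_nat i ++ enc_opt (g n i)).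
Definition computable_fun_nat (h : nat -> nat -> nat) : Prop :=
  computable (fun s => exists n k, s = enc_nat n ++ enc_nat k ++ enc_nat (h n k)).

Local Open Scope ring_scope.

Definition is_prefix (s : seq bool) (X : oracle) : Prop :=
  forall i, (i < size s)%N -> X i = nth false s i.

Definition dyad (n : nat) : rat := (2%:R ^+ n)^-1.

(* Lebesgue measure of the open set generated by a finite set of cylinders *)
Definition measure_fin (S : seq (seq bool)) : rat :=
  let L := \max_(s <- S) size s in
  (#|[set t : L.-tuple bool | has (fun s => prefix s t) S]|)%:R * dyad L.

Definition stage_measure (g : nat -> nat -> option (seq bool)) (n N : nat) : rat :=
  measure_fin (pmap id [seq g n i | i <- iota 0 N]).

(* Schnorr test: uniformly c.e. sequence U_n = ⋃_i [g n i] with μ(U_n) <= 2^-n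
   and μ(U_n) uniformly computable (h n k / 2^k is within 2^-k of μ(U_n) = sup_N stage). *)
Definition schnorr_test (g : nat -> nat -> option (seq bool)) : Prop :=
  computable_fun_opt g /\
  (forall n N, stage_measure g n N <= dyad n) /\
  exists h : nat -> nat -> nat, computable_fun_nat h /\
    forall n k,
      (forall N, stage_measure g n N <= (h n k)%:R * dyad k + dyad k) /\
      (exists N, (h n k)%:R * dyad k - dyad k <= stage_measure g n N).

Definition schnorr_random (A : oracle) : Prop :=
  forall g, schnorr_test g ->
    ~ (forall n, exists i s, g n i = Some s /\ is_prefix s A).

Definition null_set (P : oracle -> Prop) : Prop :=
  forall k, exists c : nat -> seq bool,
    (forall N, \sum_(i < N) dyad (size (c i)) <= dyad k) /\
    (forall X, P X -> exists i, is_prefix (c i) X).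

(* Main.v *)
(* Idea.  A computable language [L] with at most one string per length is built by diagonalization:
   at length [n] it receives the least string of length [n] that a candidate machine, chosen from
   [n] so that every machine recurs infinitely often, rejects within a superpolynomial number of
   steps.  The cylinders of the strings of [L] of length [> n] form a Schnorr test, so a Schnorr
   random [A] has no prefix in [L] of length [> N], for some [N].  Restricted to lengths [> N], [L]
   is then decided with oracle [A] by rejecting in polynomial time the prefixes of [A] and running
   a slow decision procedure elsewhere.  If [A] were low for speed, an oracle-free machine would
   reject all prefixes of [A] in polynomial time; at a large length where it is the candidate, [L]
   receives a string that it rejects, a contradiction.  The same cylinders cover the low for speed
   oracles.  Only computability of [L] matters, so [L] is obtained from primitive recursive
   functions, which are compiled through while programs to one-tape machines that hold each
   register in unary on its own track. *)
From HB Require Import structures.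
Require Import Defs.
From mathcomp Require Import all_boot all_order all_algebra zify.
From Stdlib Require Import Classical.
Set Implicit Arguments. Unset Strict Implicit. Unset Printing Implicit Defensive.
Import Order.TTheory GRing.Theory Num.Theory.

(** * Machine runs on a one-way tape *)

(** Lowness bounds the oracle-free machine only through the time [f] of the oracle machine, and [f]
    is known to be polynomial only on prefixes of [A]. The argument asks for no more: speed is used
    at a prefix of [A], and on the string put into the language only the correctness of the machine
    is used, however long its run. One string per length makes all lengths above [n] weigh at most
    2^-n. The same bound applied to the lengths above [k] shows that a finite count up to length [k]
    gives each measure to within 2^-k, which is what a Schnorr test requires beyond enumerability.
    Two kinds of machine have to be built in the concrete model. The decider of the language may be
    arbitrarily slow, so it goes through a generic compiler without any time analysis. The prefix
    checker needs a polynomial bound, so it is written by hand. *)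

Definition upd (B : Type) (T : nat -> B) (p : nat) (a : B) : nat -> B :=
  fun i => if i == p then a else T i.

Lemma upd_same B (T : nat -> B) p a : upd T p a p = a.
Proof. by rewrite /upd eqxx. Qed.

Lemma upd_other B (T : nat -> B) p a i : i != p -> upd T p a i = T i.
Proof. by rewrite /upd => /negbTE->. Qed.

(* The tape is the total function [T]; [c_right] may omit trailing blanks, [c_left] is exact. *)
Record represents (M : OTM) (c : config M) (q : state M) (p : nat)
    (T : nat -> symb M) (w : seq bool) : Prop := Represents {
  represents_state : c_state c = q;
  represents_left : c_left c = [seq T i | i <- rev (iota 0 p)];
  represents_head : c_head c = T p;
  represents_right : forall i, nth (blank M) (c_right c) i = T (p + i.+1);
  represents_query : c_query c = w }.

Lemma represents_ext M (c : config M) q p T T' w :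
  T =1 T' -> represents c q p T w -> represents c q p T' w.
Proof.
move=> eT [h1 h2 h3 h4 h5]; split=> //; first by rewrite h2; apply: eq_map.
- by rewrite h3 eT.
- by move=> i; rewrite h4 eT.
Qed.

Definition push (a : qact) (w : seq bool) :=
  if a is QPush b then b :: w else w.

Definition move_pos (m : move) (p : nat) :=
  match m with MoveL => p.-1 | MoveR => p.+1 | Stay => p end.

Lemma rev_iotaS p : rev (iota 0 p.+1) = p :: rev (iota 0 p).
Proof. by rewrite -addn1 iotaD rev_cat add0n. Qed.

Lemma map_upd_iota B (T : nat -> B) p q a : p <= q ->
  [seq upd T q a i | i <- rev (iota 0 p)] = [seq T i | i <- rev (iota 0 p)].
Proof.
move=> le_pq; apply/eq_in_map => i; rewrite mem_rev mem_iota => h.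
by apply: upd_other; lia.
Qed.

Section Step.
Variables (M : OTM) (X : oracle).
Implicit Types (c : config M) (T : nat -> symb M).

(** At the left end the model answers a left move by creating a blank cell, which would shift every
    position of [T]. The last hypothesis excludes this; the machines below respect it by flagging
    cell 0. *)
Lemma represents_step c q p T w q' a m k :
  represents c q p T w ->
  ~~ ((q == q_acc M) || (q == q_rej M)) -> q != q_query M ->
  trans M q (T p) = (q', a, m, k) -> (m = MoveL -> 0 < p) ->
  represents (step M X c) q' (move_pos m p) (upd T p a) (push k w).
Proof.
case=> h1 h2 h3 h4 h5 nh nq ht hp.
rewrite /step /halted h1 (negbTE nh) (negbTE nq) h3 ht h2.
case: m ht hp => ht hp /=.
- case: p h2 h3 h4 ht hp => [|p] h2 h3 h4 ht hp; first by have := hp erefl.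
  rewrite rev_iotaS /=; split=> //=.
  + by rewrite map_upd_iota //; lia.
  + by rewrite upd_other //; lia.
  + case=> [|i]; first by rewrite /= addn1 upd_same.
    by rewrite /= h4 upd_other -?addSnnS //; lia.
  + by rewrite h5; case: k ht.
- have h6 i : nth (blank M) (c_right c) i = upd T p a (p + i.+1).
    by rewrite h4 upd_other //; lia.
  case: (c_right c) h6 => [|b r] h6 /=; split=> //=.
  + by rewrite rev_iotaS /= map_upd_iota // upd_same.
  + by rewrite -addn1 -h6.
  + by move=> i; rewrite addSnnS -h6 nth_nil.
  + by rewrite h5; case: k ht.
  + by rewrite rev_iotaS /= map_upd_iota // upd_same.
  + by rewrite -addn1 -h6.
  + by move=> i; rewrite addSnnS -h6.
  + by rewrite h5; case: k ht.
- split=> //=.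
  + by rewrite map_upd_iota.
  + by rewrite upd_same.
  + by move=> i; rewrite h4 upd_other //; lia.
  + by rewrite h5; case: k ht.
Qed.

Lemma represents_query_step c q p T w :
  represents c q p T w -> q = q_query M ->
  ~~ ((q == q_acc M) || (q == q_rej M)) ->
  represents (step M X c) (if X (str_index (rev w)) then q_yes M else q_no M)
    p T [::].
Proof.
case=> h1 h2 h3 h4 h5 eq nh.
by rewrite /step /halted h1 (negbTE nh) eq eqxx h5; split.
Qed.

Definition tape_of (x : seq bool) : nat -> symb M :=
  fun i => nth (blank M) (map (enc_bit M) x) i.

Lemma represents_init x : represents (init M x) (q_start M) 0 (tape_of x) [::].
Proof. by case: x => [|b x]; split=> //= i; rewrite /tape_of /= nth_nil. Qed.

Definition reach (n : nat) c c' := iter n (step M X) c = c'.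

Lemma reach_trans n m c c' c'' :
  reach n c c' -> reach m c' c'' -> reach (n + m) c c''.
Proof. by rewrite /reach addnC iterD => ->. Qed.

Lemma step_halted c : halted c -> step M X c = c.
Proof. by rewrite /step => ->. Qed.

Lemma iter_step_halted c n : halted c -> iter n (step M X) c = c.
Proof. by move=> h; elim: n => //= n ->; apply: step_halted. Qed.

Lemma run_halted_le x t u : t <= u -> halted (run M X x t) ->
  run M X x u = run M X x t.
Proof. by move=> /subnK<- h; rewrite {1}/run iterD iter_step_halted. Qed.

Definition special (q : state M) := [|| q == q_acc M, q == q_rej M | q == q_query M].

Lemma represents_move c q p T w q' a m k :
  represents c q p T w -> ~~ special q ->
  trans M q (T p) = (q', a, m, k) -> (m = MoveL -> 0 < p) ->
  exists2 c', reach 1 c c' & represents c' q' (move_pos m p) (upd T p a) (push k w).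
Proof.
move=> h; rewrite /special orbA negb_or => /andP[n1 n2] ht hp.
by exists (step M X c) => //; apply: represents_step h n1 n2 ht hp.
Qed.

Lemma represents_trans c q p T w :
  represents c q p T w -> ~~ special q ->
  let: (q', a, m, k) := trans M q (T p) in
  (if m is MoveL then 0 < p else true) ->
  exists2 c', reach 1 c c' & represents c' q' (move_pos m p) (upd T p a) (push k w).
Proof.
move=> h ns; case e: (trans _ _ _) => [[[q' a] m] k] hp.
by apply: represents_move h ns e _ => em; rewrite em in hp.
Qed.

Lemma represents_scan_right c q p d T U w :
  represents c q p T w -> ~~ special q ->
  (forall i, p <= i < p + d -> trans M q (T i) = (q, U i, MoveR, QNop)) ->
  exists2 c', reach d c c' &
    represents c' q (p + d) (fun i => if p <= i < p + d then U i else T i) w.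
Proof.
move=> h ns; elim: d => [|d IH] ht.
  exists c => //; rewrite addn0; apply: represents_ext h => i.
  by case: ifP => //; lia.
have [|c' h1 h2] := IH; first by move=> i hi; apply: ht; lia.
have [||c'' h3 h4] := represents_move (q' := q) (a := U (p + d)) (m := MoveR) (k := QNop) h2 ns.
- by rewrite ifF ?ht //; lia.
- by [].
exists c''; first by rewrite -addn1; apply: reach_trans h1 h3.
rewrite addnS; apply: represents_ext h4 => i; rewrite /upd.
by case: eqP => [->|ne]; [rewrite ifT //; lia | congr (if _ then _ else _); lia].
Qed.

Lemma represents_skip_right c q p d T w :
  represents c q p T w -> ~~ special q ->
  (forall i, p <= i < p + d -> trans M q (T i) = (q, T i, MoveR, QNop)) ->
  exists2 c', reach d c c' & represents c' q (p + d) T w.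
Proof.
move=> h ns ht; have [c' h1 h2] := represents_scan_right h ns ht.
by exists c' => //; apply: represents_ext h2 => i; case: ifP.
Qed.

(** The action may depend on the position, so that this pass can copy tape bits to the query tape.
    Cell [p] is pushed first and cell 1 last, hence the right fold over increasing positions. *)
Lemma represents_scan_left c q p T w (k : nat -> qact) :
  represents c q p T w -> ~~ special q ->
  (forall i, 0 < i <= p -> trans M q (T i) = (q, T i, MoveL, k i)) ->
  exists2 c', reach p c c' &
    represents c' q 0 T (foldr (fun i => push (k i)) w (iota 1 p)).
Proof.
elim: p c w => [|p IH] c w h ns ht; first by exists c.
have [||c' h1 h2] := represents_move (q' := q) (a := T p.+1) (m := MoveL) (k := k p.+1) h ns.
- by rewrite ht //; lia.
- by [].
have [|//||c'' h3 h4] := IH c' (push (k p.+1) w).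
- apply: represents_ext h2 => i; rewrite /upd; by case: eqP => // ->.
- by move=> i hi; apply: ht; lia.
exists c''; first by rewrite -add1n; apply: reach_trans h1 h3.
suff -> : iota 1 p.+1 = iota 1 p ++ [:: p.+1] by rewrite foldr_cat.
by rewrite -{1}[p.+1]addn1 iotaD add1n.
Qed.

Lemma represents_return c q p T w :
  represents c q p T w -> ~~ special q ->
  (forall i, 0 < i <= p -> trans M q (T i) = (q, T i, MoveL, QNop)) ->
  exists2 c', reach p c c' & represents c' q 0 T w.
Proof.
move=> h ns /(represents_scan_left (k := fun=> QNop) h ns)[c' h1 h2].
exists c' => //; suff <-: foldr (fun i => push QNop) w (iota 1 p) = w by [].
by elim: (iota 1 p).
Qed.

End Step.

(** * Register machines *)
Inductive instr :=
  | IInc of nat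
  | IDec of nat
  | IIfZ of nat & nat & nat
  | IRead of nat & nat & nat.

Definition instr_reg (i : instr) : nat :=
  match i with IInc r | IDec r | IIfZ r _ _ => r | IRead _ _ _ => 0 end.

Record gstate := GState { g_pc : nat; g_store : nat -> nat; g_input : seq bool }.

(* A program counter outside [code] means that the program has stopped. *)
Definition gstep (code : seq instr) (z : gstate) : gstate :=
  let: GState pc s x := z in
  if pc < size code then
    match nth (IInc 0) code pc with
    | IInc r => GState pc.+1 (upd s r (s r).+1) x
    | IDec r => GState pc.+1 (upd s r (s r).-1) x
    | IIfZ r a b => GState (if s r == 0 then a else b) s x
    | IRead a0 a1 ae =>
        match x with
        | [::] => GState ae s x
        | b :: x' => GState (if b then a1 else a0) s x'
        end
    end
  else z.

Lemma leq_bigmax_nth (T : Type) (x0 : T) (l : seq T) (F : T -> nat) i :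
  i < size l -> F (nth x0 l i) <= \max_(a <- l) F a.
Proof.
elim: l i => [//|a l IH] [|i] h; rewrite big_cons leq_max ?leqnn //=.
by rewrite IH ?orbT.
Qed.

Section Machine.
Variable code : seq instr.

Definition max_reg := \max_(i <- code) instr_reg i.
Definition gsymb : finType :=
  ((bool * (option bool * bool)) * {ffun 'I_max_reg.+1 -> bool})%type.
Definition gpc := 'I_(size code).+1.
(** The left summand holds the four special states, the right one a program counter with a phase.
    [p_fwd] and [p_erase] serve [IDec], which finds the last mark of a track by overshooting it by
    one cell; [p_ret] brings the head back to the left end. *)
Definition gctl : finType := ((bool * bool) + gpc * (bool * bool))%type.

Definition goto (a : nat) : gpc := inord (minn a (size code)).
Definition p_main := (false, false).
Definition p_fwd := (true, false).
Definition p_erase := (false, true).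
Definition p_ret := (true, true).
Definition s_init : gctl := inl (false, false).
Definition s_acc : gctl := inl (true, false).
Definition s_rej : gctl := inl (false, true).
Definition s_query : gctl := inl (true, true).

(* A cell carries a left-end flag, an input bit with a "consumed" mark, and one track per
   register; register [r] has value [v] when track [r] is set exactly on the cells [0..v-1]. *)
Definition gsym (flag : bool) (i : option bool * bool)
  (t : {ffun 'I_max_reg.+1 -> bool}) : gsymb := ((flag, i), t).
Definition track (a : gsymb) (r : nat) : bool := a.2 (inord r).
Definition set_track (a : gsymb) (r : nat) (b : bool) : gsymb :=
  (a.1, [ffun j => if j == inord r then b else a.2 j]).

Definition gtrans (q : gctl) (a : gsymb) : gctl * gsymb * move * qact :=
  match q with
  | inl (false, false) => (inr (goto 0, p_main), ((true, a.1.2), a.2), Stay, QNop)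
  | inl _ => (q, a, Stay, QNop)
  | inr (pc, (true, true)) =>
      if a.1.1 then (inr (pc, p_main), a, Stay, QNop) else (q, a, MoveL, QNop)
  | inr (pc, ph) =>
      if (pc < size code)%N then
        match nth (IInc 0) code pc with
        | IInc r =>
            if track a r then (q, a, MoveR, QNop)
            else (inr (goto pc.+1, p_ret), set_track a r true, Stay, QNop)
        | IDec r =>
            match ph with
            | (false, false) =>
                if track a r then (inr (pc, p_fwd), a, MoveR, QNop)
                else (inr (goto pc.+1, p_main), a, Stay, QNop)
            | (true, _) =>
                if track a r then (q, a, MoveR, QNop)
                else (inr (pc, p_erase), a, MoveL, QNop)
            | _ => (inr (goto pc.+1, p_ret), set_track a r false, Stay, QNop)
            end
        | IIfZ r a0 a1 =>
            (inr (goto (if track a r then a1 else a0), p_main), a, Stay, QNop)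
        | IRead a0 a1 ae =>
            if a.1.2.2 then (q, a, MoveR, QNop) else
            match a.1.2.1 with
            | Some b =>
                (inr (goto (if b then a1 else a0), p_ret),
                  ((a.1.1, (Some b, true)), a.2), Stay, QNop)
            | None => (inr (goto ae, p_ret), a, Stay, QNop)
            end
        end
      else (if track a 0 then s_acc else s_rej, a, Stay, QNop)
  end.

Definition gblank : gsymb := gsym false (None, false) [ffun=> false].
Definition gbit (b : bool) : gsymb := gsym false (Some b, false) [ffun=> false].

Definition gmachine : OTM := {|
  state := gctl; symb := gsymb; blank := gblank; bit0 := gbit false; bit1 := gbit true;
  q_start := s_init; q_acc := s_acc; q_rej := s_rej;
  q_query := s_query; q_yes := s_query; q_no := s_query; trans := gtrans |}.

Definition gtape (x : seq bool) (k : nat) (s : nat -> nat) : nat -> symb gmachine :=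
  fun i => gsym (i == 0) (if i < size x then (Some (nth false x i), i < k) else (None, false))
             [ffun r : 'I_max_reg.+1 => i < s r].

Lemma track_gtape x k s i r : r <= max_reg -> track (gtape x k s i) r = (i < s r).
Proof. by move=> h; rewrite /track ffunE inordK. Qed.

Lemma not_special z : ~~ special (M := gmachine) (inr z).
Proof. by []. Qed.

Lemma gotoK pc : pc < size code -> goto pc = pc :> nat.
Proof. by move=> h; rewrite /goto (minn_idPl (ltnW h)) inordK // ltnS ltnW. Qed.

Lemma leq_reg pc : pc < size code -> instr_reg (nth (IInc 0) code pc) <= max_reg.
Proof.
by move=> h; apply: leq_bigmax_nth. 
Qed.

Variable X : oracle.
Notation reach := (@reach gmachine X).

(** The invariant between two instructions, with the head on cell 0. Here [k] counts the input bits
    consumed so far, which stay on the tape under a mark. *)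
Definition at_main (z : gstate) (x : seq bool) (c : config gmachine) :=
  exists2 k, g_input z = drop k x & k <= size x /\
    represents c (inr (goto (g_pc z), p_main) : state gmachine) 0 (gtape x k (g_store z)) [::].

Lemma return_main c (pc : gpc) x k s p :
  represents c (inr (pc, p_ret) : state gmachine) p (gtape x k s) [::] ->
  exists n c', reach n c c' /\
    represents c' (inr (pc, p_main) : state gmachine) 0 (gtape x k s) [::].
Proof.
move=> h.
have [|c1 r1 h1] := represents_return X h (not_special _).
  by move=> [|i] hi.
have [//|c2 r2 h2] := represents_trans X h1 (not_special _).
exists (p + 1), c2; split; first exact: reach_trans r1 r2.
by apply: represents_ext h2 => i /=; rewrite /upd; case: eqP => // ->.
Qed.

Lemma gtape_inc x k s i r : r <= max_reg ->
  upd (gtape x k s) (s r) (set_track (gtape x k s (s r)) r true) i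
    = gtape x k (upd s r (s r).+1) i.
Proof.
move=> hr; rewrite /upd; case: eqP => [->|ne]; rewrite /gtape /set_track /gsym /=;
  congr (_, _); apply/ffunP => j; rewrite !ffunE.
- by rewrite -val_eqE /= inordK //; case: eqP => ej; rewrite ?ej; lia.
- by case: eqP => ej; rewrite ?ej; lia.
Qed.

Lemma gtape_dec x k s i r : r <= max_reg -> 0 < s r ->
  upd (gtape x k s) (s r).-1 (set_track (gtape x k s (s r).-1) r false) i
    = gtape x k (upd s r (s r).-1) i.
Proof.
move=> hr s0; rewrite /upd; case: eqP => [->|ne]; rewrite /gtape /set_track /gsym /=;
  congr (_, _); apply/ffunP => j; rewrite !ffunE.
- by rewrite -val_eqE /= inordK //; case: eqP => ej; rewrite ?ej; lia.
- by case: eqP => ej; rewrite ?ej; lia.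
Qed.

Lemma upd_gtape x k s p i : upd (gtape x k s) p (gtape x k s p) i = gtape x k s i.
Proof. by rewrite /upd; case: eqP => // ->. Qed.

Lemma drop_cons x k : k <= size x ->
  match drop k x with
  | [::] => size x = k
  | b :: y' => [/\ k < size x, nth false x k = b & drop k.+1 x = y']
  end.
Proof.
rewrite leq_eqVlt => /predU1P[->|h]; first by rewrite drop_size.
by rewrite (drop_nth false h).
Qed.

Lemma run_gstep z x c : at_main z x c -> g_pc z < size code ->
  exists n c', reach n c c' /\ at_main (gstep code z) x c'.
Proof.
case: z => pc s y [k /= -> [hk h]] hpc.
rewrite /gstep hpc.
have hpc' : goto pc = pc :> nat by apply: gotoK.
have hr := leq_reg hpc.
case ei : (nth (IInc 0) code pc) hr => [r|r|r a0 a1|a0 a1 ae] /= hr.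
- have [|c1 r1 h1] := represents_skip_right (d := s r) X h (not_special _).
    move=> i hi; rewrite /trans /= hpc' hpc ei track_gtape //.
    by rewrite ifT //; lia.
  have := represents_trans X h1 (not_special _).
  rewrite /trans /= hpc' hpc ei track_gtape // add0n ltnn => /(_ isT)[c2 r2 h2].
  have [n [c3 [r3 h3]]] : exists n c3, reach n c2 c3 /\ represents c3
    (inr (goto pc.+1, p_main) : state gmachine) 0 (gtape x k (upd s r (s r).+1)) [::].
    apply: (@return_main _ _ _ _ _ (s r)).
    by apply: represents_ext h2 => i; rewrite gtape_inc.
  exists (s r + 1 + n), c3; split; last by exists k.
  by apply: reach_trans r3; apply: reach_trans r1 r2.
- case: (posnP (s r)) => [s0|s0].
    have := represents_trans X h (not_special _).
    rewrite /trans /= hpc' hpc ei track_gtape // s0 => /(_ isT)[c1 r1 h1].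
    exists 1, c1; split=> //; exists k => //; split=> //=.
    apply: represents_ext h1 => i; rewrite upd_gtape.
    rewrite /gtape; congr gsym; apply/ffunP => j; rewrite !ffunE /upd.
    by case: eqP => // ->; rewrite s0.
  have := represents_trans X h (not_special _).
  rewrite /trans /= hpc' hpc ei track_gtape // s0 => /(_ isT)[c1 r1 h1].
  have {}h1 := represents_ext (upd_gtape x k s 0) h1.
  have [|c2 r2 h2] := represents_skip_right (d := (s r).-1) X h1 (not_special _).
    move=> i hi; rewrite /trans /= hpc' hpc ei track_gtape //.
    by rewrite ifT //; move: hi => /=; lia.
  have := represents_trans X h2 (not_special _).
  rewrite /trans /= hpc' hpc ei track_gtape // ifF => [/(_ isT)[c3 r3 h3]|]; last by lia.
  have {}h3 := represents_ext (upd_gtape x k s _) h3.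
  have := represents_trans X h3 (not_special _).
  rewrite /trans /= hpc' hpc ei => /(_ isT)[c4 r4 h4].
  have [n [c5 [r5 h5]]] : exists n c5, reach n c4 c5 /\ represents c5
    (inr (goto pc.+1, p_main) : state gmachine) 0 (gtape x k (upd s r (s r).-1)) [::].
    apply: (@return_main _ _ _ _ _ (s r).-1).
    by apply: represents_ext h4 => i; rewrite /= -gtape_dec.
  exists (1 + (s r).-1 + 1 + 1 + n), c5; split; last by exists k.
  do 3 (apply: reach_trans; last by eassumption).
  exact: reach_trans r1 r2.
- have := represents_trans X h (not_special _).
  rewrite /trans /= hpc' hpc ei track_gtape // => /(_ isT)[c1 r1 h1].
  exists 1, c1; split=> //; exists k => //; split=> //=.
  rewrite lt0n in h1; have {}h1 := represents_ext (upd_gtape x k s _) h1.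
  by case: (s r == 0) h1.
- have [|c1 r1 h1] := represents_skip_right (d := k) X h (not_special _).
    move=> i hi; rewrite /trans /= hpc' hpc ei /=.
    by rewrite ifT ?ifT //; lia.
  have := drop_cons hk; case: (drop k x) => [|b y'].
    move=> e; have := represents_trans X h1 (not_special _).
    rewrite /trans /= hpc' hpc ei /= ?add0n e ltnn /= => /(_ isT)[c2 r2 h2].
    have {}h2 := represents_ext (upd_gtape x k s _) h2.
    have [n [c3 [r3 h3]]] := return_main h2.
    exists (k + 1 + n), c3; split; last by exists k; rewrite // -e drop_size.
    by apply: reach_trans r3; apply: reach_trans r1 r2.
  case=> hk' eb ey.
  have := represents_trans X h1 (not_special _).
  rewrite /trans /= hpc' hpc ei /= ?add0n hk' /= ltnn eb => /(_ isT)[c2 r2 h2].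
  have {}h2 := @represents_ext _ _ _ _ _ (gtape x k.+1 s) _ _ h2.
  have [|n [c3 [r3 h3]]] := return_main (h2 _).
    move=> i; rewrite /upd ?add0n; case: eqP => [->|ne].
      by rewrite /gtape /gsym /= hk' eb ltnSn.
    by rewrite /gtape; congr (gsym _ (if _ then (_, _) else _) _); lia.
  exists (k + 1 + n), c3; split; last by exists k.+1.
  by apply: reach_trans r3; apply: reach_trans r1 r2.
Qed.

Lemma run_gsteps z x c n : at_main z x c ->
  exists m c', reach m c c' /\ at_main (iter n (gstep code) z) x c'.
Proof.
elim: n => [|n IH] h; first by exists 0, c.
have [m [c1 [r1 h1]]] := IH h; rewrite iterS.
set z1 := iter n _ z in h1 *.
have [lt|ge] := ltnP (g_pc z1) (size code).
  have [m' [c2 [r2 h2]]] := run_gstep h1 lt.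
  by exists (m + m'), c2; split=> //; apply: reach_trans r1 r2.
exists m, c1; split=> //; rewrite /gstep.
by case: z1 ge h1 => pc s y /=; rewrite ltnNge => ->.
Qed.

Lemma run_ginit x : exists2 c, reach 1 (init gmachine x) c &
  at_main (GState 0 (fun=> 0) x) x c.
Proof.
have [//|//|c r h] := represents_trans X (represents_init gmachine x) _.
exists c => //; exists 0; first by rewrite drop0.
split=> //; apply: represents_ext h => i.
rewrite /upd; case: eqP => [->|/eqP ne]; rewrite /gtape /tape_of.
  by case: x {r} => [|[] x] /=; congr pair; apply/ffunP => j; rewrite !ffunE.
rewrite (negbTE ne); case: ltnP => h'.
  rewrite (nth_map false) // /enc_bit; case: (nth _ _ _) => /=; congr (_, _);
  by apply/ffunP => j; rewrite !ffunE.
by rewrite nth_default ?size_map.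
Qed.

(** The head stops on cell 0, whose track 0 is set exactly when register 0 is nonzero: this bit is
    the verdict. *)
Lemma run_ghalt x n s y : iter n (gstep code) (GState 0 (fun=> 0) x) = GState (size code) s y ->
  exists t, halted (run gmachine X x t) /\
    (c_state (run gmachine X x t) = q_acc gmachine <-> s 0 != 0).
Proof.
move=> e; have [c r h] := run_ginit x.
have [m [c1 [r1]]] := run_gsteps n h; rewrite e => -[k /= _ [_ h1]].
have := represents_trans X h1 (not_special _); rewrite /trans /= track_gtape //.
  rewrite /goto minnn inordK // ltnn => /(_ isT)[c2 r2 h2].
exists (1 + m + 1).
have -> : run gmachine X x (1 + m + 1) = c2.
  by apply: reach_trans r2; apply: reach_trans r r1.
rewrite /halted (represents_state h2) lt0n.
by case: (s 0).
Qed.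

End Machine.

(** * While programs *)
Inductive cmd :=
  | CInc of nat
  | CDec of nat
  | CSeq of cmd & cmd
  | CWhile of nat & cmd
  | CRead of cmd & cmd.

Inductive exec : cmd -> (nat -> nat) -> seq bool -> (nat -> nat) -> seq bool -> Prop :=
  | ExInc r s x : exec (CInc r) s x (upd s r (s r).+1) x
  | ExDec r s x : exec (CDec r) s x (upd s r (s r).-1) x
  | ExSeq c1 c2 s1 x1 s2 x2 s3 x3 :
      exec c1 s1 x1 s2 x2 -> exec c2 s2 x2 s3 x3 -> exec (CSeq c1 c2) s1 x1 s3 x3
  | ExWhileEnd r c s x : s r = 0 -> exec (CWhile r c) s x s x
  | ExWhile r c s1 x1 s2 x2 s3 x3 : s1 r <> 0 ->
      exec c s1 x1 s2 x2 -> exec (CWhile r c) s2 x2 s3 x3 ->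
      exec (CWhile r c) s1 x1 s3 x3
  | ExReadEnd c0 c1 s : exec (CRead c0 c1) s [::] s [::]
  | ExRead c0 c1 s1 (b : bool) x1 s2 x2 s3 x3 :
      exec (if b then c1 else c0) s1 x1 s2 x2 -> exec (CRead c0 c1) s2 x2 s3 x3 ->
      exec (CRead c0 c1) s1 (b :: x1) s3 x3.

Definition jump a := IIfZ 0 a a.

Fixpoint code_size (c : cmd) : nat :=
  match c with
  | CInc _ | CDec _ => 1
  | CSeq c1 c2 => code_size c1 + code_size c2
  | CWhile _ c => (code_size c).+2
  | CRead c0 c1 => (code_size c0 + code_size c1).+3
  end.

Fixpoint compile (c : cmd) (a : nat) : seq instr :=
  match c with
  | CInc r => [:: IInc r]
  | CDec r => [:: IDec r]
  | CSeq c1 c2 => compile c1 a ++ compile c2 (a + code_size c1)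
  | CWhile r c =>
      IIfZ r (a + (code_size c).+2) a.+1 :: compile c a.+1 ++ [:: jump a]
  | CRead c0 c1 =>
      IRead a.+1 (a + (code_size c0).+2) (a + (code_size c0 + code_size c1).+3)
        :: compile c0 a.+1 ++ jump a :: compile c1 (a + (code_size c0).+2) ++ [:: jump a]
  end.

Lemma size_compile c a : size (compile c a) = code_size c.
Proof.
elim: c a => //= [c1 IH1 c2 IH2|r c IH|c1 IH1 c2 IH2] a.
- by rewrite size_cat IH1 IH2.
- by rewrite size_cat IH addn1.
- by rewrite !(size_cat, IH1, IH2) /= size_cat IH2 /=; lia.
Qed.

Lemma gstep_nth code pre i post s x :
  code = pre ++ i :: post ->
  gstep code (GState (size pre) s x) =
  match i with
  | IInc r => GState (size pre).+1 (upd s r (s r).+1) x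
  | IDec r => GState (size pre).+1 (upd s r (s r).-1) x
  | IIfZ r a b => GState (if s r == 0 then a else b) s x
  | IRead a0 a1 ae =>
      match x with
      | [::] => GState ae s x
      | b :: x' => GState (if b then a1 else a0) s x'
      end
  end.
Proof.
by move=> ->; rewrite /gstep size_cat /= -addSnnS leq_addr nth_cat ltnn subnn.
Qed.

Definition greach code z z' := exists n, iter n (gstep code) z = z'.

Lemma greach_trans code z z' z'' :
  greach code z z' -> greach code z' z'' -> greach code z z''.
Proof. by move=> [n h] [m h']; exists (m + n); rewrite iterD h. Qed.

Lemma greach_step code z : greach code z (gstep code z).
Proof. by exists 1. Qed.

(** The induction is on the execution, since a loop unfolds to a shorter execution of the same loop.
    The surrounding code [pre] and [post] is arbitrary because jump addresses are absolute. *)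
Lemma compile_correct c s x s' x' : exec c s x s' x' ->
  forall code pre post, code = pre ++ compile c (size pre) ++ post ->
  greach code (GState (size pre) s x) (GState (size pre + code_size c) s' x').
Proof.
have jumpE code pre post a s0 y : code = pre ++ jump a :: post ->
    greach code (GState (size pre) s0 y) (GState a s0 y).
  by move=> e; have := greach_step code (GState (size pre) s0 y);
     rewrite (gstep_nth _ _ e) /= if_same.
elim=> {c s x s' x'}.
- move=> r s x code pre post e.
  by rewrite addn1 -(gstep_nth _ _ e); apply: greach_step.
- move=> r s x code pre post e.
  by rewrite addn1 -(gstep_nth _ _ e); apply: greach_step.
- move=> c1 c2 s1 x1 s2 x2 s3 x3 _ IH1 _ IH2 code pre post /= e.
  have := IH1 code pre (compile c2 (size pre + code_size c1) ++ post).
  move=> /(_ _)/greach_trans; apply; first by rewrite e -?catA.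
  have := IH2 code (pre ++ compile c1 (size pre)) post.
  by rewrite size_cat size_compile -addnA; apply; rewrite e -?catA.
- move=> r c s x s0 code pre post e.
  have := greach_step code (GState (size pre) s x).
  by rewrite (gstep_nth _ _ e) s0 eqxx.
- move=> r c s1 x1 s2 x2 s3 x3 /eqP/negbTE nz _ IH1 _ IH2 code pre post e.
  have := greach_step code (GState (size pre) s1 x1).
  rewrite (gstep_nth _ _ e) nz => /greach_trans; apply.
  have := IH1 code (rcons pre (IIfZ r (size pre + (code_size c).+2) (size pre).+1))
    (jump (size pre) :: post).
  rewrite size_rcons => h; apply: greach_trans (h _) _.
    by rewrite e -cats1 /= -?catA.
  apply: greach_trans (IH2 _ _ _ e).
  have := jumpE code (pre ++ IIfZ r (size pre + (code_size c).+2) (size pre).+1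
     :: compile c (size pre).+1) post (size pre).
  rewrite size_cat /= size_compile addSnnS; apply.
  by rewrite e /= -?catA /= -?catA.
- move=> c0 c1 s code pre post e.
  have := greach_step code (GState (size pre) s [::]).
  by rewrite (gstep_nth _ _ e).
- move=> c0 c1 s1 b x1 s2 x2 s3 x3 _ IH1 _ IH2 code pre post e.
  have := greach_step code (GState (size pre) s1 (b :: x1)).
  rewrite (gstep_nth _ _ e) => /greach_trans; apply.
  apply: greach_trans (IH2 _ _ _ e).
  move: e; rewrite /= -?catA /= -?catA /=.
  set i := IRead _ _ _ => e.
  case: b IH1 => IH1.
  + have := IH1 code (pre ++ i :: compile c0 (size pre).+1 ++ [:: jump (size pre)])
      (jump (size pre) :: post).
    rewrite size_cat /= size_cat size_compile /= addn1 => h.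
    apply: greach_trans (h _) _; first by rewrite e -?catA /= -?catA.
    have := jumpE code (pre ++ i :: compile c0 (size pre).+1 ++ jump (size pre) ::
      compile c1 (size pre + (code_size c0).+2)) post (size pre).
    have -> : size pre + (code_size c0).+2 + code_size c1 =
      size pre + (code_size c0 + (code_size c1).+1).+1 by lia.
    by rewrite size_cat /= size_cat /= !size_compile; apply; rewrite e -?catA /= -?catA.
  + have := IH1 code (rcons pre i) (jump (size pre) ::
      compile c1 (size pre + (code_size c0).+2) ++ jump (size pre) :: post).
    rewrite size_rcons => h; apply: greach_trans (h _) _; first by rewrite e -cats1 -catA.
    have := jumpE code (pre ++ i :: compile c0 (size pre).+1)
      (compile c1 (size pre + (code_size c0).+2) ++ jump (size pre) :: post) (size pre).
    by rewrite size_cat /= size_compile addSnnS; apply; rewrite e -?catA.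
Qed.

Lemma exec_decides (c : cmd) (P : seq bool -> bool) :
  (forall x, exists s y, exec c (fun=> 0) x s y /\ (s 0 != 0) = P x) -> computable P.
Proof.
move=> h; exists (gmachine (compile c 0)) => x.
have [s [y [/compile_correct hc <-]]] := h x.
have [|n] := hc (compile c 0) [::] [::]; first by rewrite cats0.
by rewrite add0n -(size_compile c 0); apply: run_ghalt.
Qed.

(** * Primitive recursive functions *)

(* De Bruijn-indexed terms.  In [Rec b s n] the step [s] sees the accumulator as variable 0 and
   the loop counter as variable 1; [Drp i e] hides variable [i] from [e]. *)
Inductive exp :=
  | Var of nat
  | Zero
  | Succ of exp
  | Let of exp & exp
  | Drp of nat & exp
  | Rec of exp & exp & exp.

Definition del (T : Type) i (v : seq T) := take i v ++ drop i.+1 v.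

Fixpoint eval (e : exp) (v : seq nat) : nat :=
  match e with
  | Var i => nth 0 v i
  | Zero => 0
  | Succ e => (eval e v).+1
  | Let a e => eval e (eval a v :: v)
  | Drp i e => eval e (del i v)
  | Rec b s n => nat_rect (fun=> nat) (eval b v) (fun k a => eval s [:: a, k & v]) (eval n v)
  end.

Definition c_clear r := CWhile r (CDec r).
Definition c_move r r' := CSeq (c_clear r') (CWhile r (CSeq (CDec r) (CInc r'))).
(** A loop reads a register only by emptying it, so the value is poured into both [r'] and [t], and
    then back from [t] into [r]. *)
Definition c_copy r r' t :=
  CSeq (c_clear r') (CSeq (c_clear t)
    (CSeq (CWhile r (CSeq (CDec r) (CSeq (CInc r') (CInc t))))
          (CWhile t (CSeq (CDec t) (CInc r))))).

(* [compile_exp e l d]: variable [i] lives in register [nth d l i] (all of them below [d]), the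
   result goes to register [d], and the registers from [d] on are scratch. *)
Fixpoint compile_exp (e : exp) (l : seq nat) (d : nat) : cmd :=
  match e with
  | Var i => if i < size l then c_copy (nth 0 l i) d d.+1 else c_clear d
  | Zero => c_clear d
  | Succ e => CSeq (compile_exp e l d) (CInc d)
  | Let a e =>
      CSeq (compile_exp a l d) (CSeq (compile_exp e (d :: l) d.+1) (c_move d.+1 d))
  | Drp i e => compile_exp e (del i l) d
  | Rec b s n =>
      CSeq (compile_exp n l d) (CSeq (compile_exp b l d.+1) (CSeq (c_clear d.+2)
        (CSeq (CWhile d (CSeq (CDec d)
                 (CSeq (compile_exp s [:: d.+1, d.+2 & l] d.+3)
                 (CSeq (c_move d.+3 d.+1) (CInc d.+2)))))
        (c_move d.+1 d))))
  end.

Lemma exec_clear r s x : exists2 s', exec (c_clear r) s x s' x & s' =1 upd s r 0.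
Proof.
elim: {s}(s r) {-2}s (erefl (s r)) => [|n IH] s e.
  by exists s; [apply: ExWhileEnd | move=> i; rewrite /upd; case: eqP => // ->].
have [|s' h1 h2] := IH (upd s r (s r).-1); first by rewrite upd_same e.
exists s'; first by apply: ExWhile h1; [rewrite e | apply: ExDec].
by move=> i; rewrite h2 /upd; case: eqP.
Qed.

Lemma exec_move r r' s x : r != r' ->
  exists2 s', exec (c_move r r') s x s' x & s' =1 upd (upd s r 0) r' (s r).
Proof.
move=> ne; have [s1 h1 e1] := exec_clear r' s x.
suff [s2 h2 e2] : exists2 s2, exec (CWhile r (CSeq (CDec r) (CInc r'))) s1 x s2 x &
    s2 =1 upd (upd s1 r 0) r' (s1 r' + s1 r).
  exists s2; first by apply: ExSeq h1 h2.
  by move=> i; rewrite e2 /upd !e1 /upd eqxx (negbTE ne); case: eqP.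
elim: {s1 h1 e1}(s1 r) {-2}s1 (erefl (s1 r)) => [|n IH] s1 e.
  exists s1; first by apply: ExWhileEnd.
  by move=> i; rewrite /upd; case: eqP => [->|_]; [rewrite e addn0 | case: eqP => // ->].
have [|s2 h2 e2] := IH (upd (upd s1 r (s1 r).-1) r' (s1 r').+1).
  by rewrite upd_other ?upd_same ?e.
exists s2.
  apply: ExWhile h2; first by rewrite e.
  apply: ExSeq (ExDec _ _ _) _.
  by have := ExInc r' (upd s1 r (s1 r).-1) x; rewrite (upd_other _ _ (i := r')) // eq_sym.
by move=> i; rewrite e2 /upd !eqxx (negbTE ne); case: eqP => _; [rewrite e; lia | case: eqP].
Qed.

Lemma exec_copy r r' t s x : r != r' -> r != t -> r' != t ->
  exists2 s', exec (c_copy r r' t) s x s' x & forall i, i != t -> s' i = upd s r' (s r) i.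
Proof.
move=> n1 n2 n3; have [s1 h1 e1] := exec_clear r' s x.
have [s2 h2 e2] := exec_clear t s1 x.
have {}e2 : [/\ s2 r = s r, s2 t = 0, s2 r' = 0 &
    forall i, i != t -> i != r' -> i != r -> s2 i = s i].
  split; rewrite ?e2 /upd ?e1 /upd ?eqxx ?(negbTE n1, negbTE n2, negbTE n3) //.
  by move=> i i1 i2 _; rewrite e2 /upd (negbTE i1) e1 /upd (negbTE i2).
suff [s3 h3 e3] : exists2 s3, exec (CWhile r (CSeq (CDec r) (CSeq (CInc r') (CInc t)))) s2 x s3 x &
    [/\ s3 r = 0, s3 t = s r, s3 r' = s r &
    forall i, i != t -> i != r' -> i != r -> s3 i = s i].
  (* Weakened to the invariant of the restoring loop: only the sum of [r] and [t] stays constant. *)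
  have {}e3 : [/\ s3 r + s3 t = s r, s3 r' = s r &
    forall i, i != t -> i != r' -> i != r -> s3 i = s i] by case: e3 => -> -> ->.
  suff [s4 h4 e4] : exists2 s4, exec (CWhile t (CSeq (CDec t) (CInc r))) s3 x s4 x &
     [/\ s4 r = s r, s4 r' = s r & forall i, i != t -> i != r' -> i != r -> s4 i = s i].
    exists s4; first exact: ExSeq h1 (ExSeq h2 (ExSeq h3 h4)).
    case: e4 => e4 e5 e6 i it; rewrite /upd; case: eqP => [->//|/eqP ir'].
    by case: (eqVneq i r) => [->//|ir]; rewrite e6.
  elim: {h3 h2 h1}(s3 t) {-2}s3 (erefl (s3 t)) e3 => [|n IH] {}s3 e [a1 a2 a3].
    exists s3; first by apply: ExWhileEnd.
    by split=> //; rewrite -a1 e addn0.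
  have [||s4 h4 e4] := IH (upd (upd s3 t (s3 t).-1) r (s3 r).+1).
  - by rewrite upd_other ?upd_same ?e // eq_sym.
  - split.
    + by rewrite upd_same upd_other ?upd_same 1?eq_sym // -a1 e; lia.
    + by rewrite !upd_other // eq_sym.
    + by move=> i i1 i2 i3; rewrite !upd_other // a3.
  exists s4 => //; apply: ExWhile h4; first by rewrite e.
  apply: ExSeq (ExDec _ _ _) _.
  by have := ExInc r (upd s3 t (s3 t).-1) x; rewrite (upd_other _ _ (i := r)).
have {}e2 : [/\ s2 r + s2 t = s r, s2 r' = s2 t &
    forall i, i != t -> i != r' -> i != r -> s2 i = s i].
  by case: e2 => -> -> -> ?; split; rewrite // addn0.
elim: {h2 h1}(s2 r) {-2}s2 (erefl (s2 r)) e2 => [|n IH] {}s2 e [a1 a2 a3].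
  exists s2; first by apply: ExWhileEnd.
  by split=> //; rewrite ?a2 -a1 e.
have [||s3 h3 e3] := IH (upd (upd (upd s2 r (s2 r).-1) r' (s2 r').+1) t (s2 t).+1).
- by rewrite upd_other // upd_other // upd_same e.
- split.
  + by rewrite upd_same upd_other // upd_other // upd_same -a1 e; lia.
  + by rewrite upd_same upd_other // upd_same a2.
  + by move=> i i1 i2 i3; rewrite !upd_other // a3.
exists s3 => //; apply: ExWhile h3; first by rewrite e.
apply: ExSeq (ExDec _ _ _) _.
apply: ExSeq.
  have := ExInc r' (upd s2 r (s2 r).-1) x.
  by rewrite (upd_other _ _ (i := r')) 1?eq_sym //; apply.
have := ExInc t (upd (upd s2 r (s2 r).-1) r' (s2 r').+1) x.
by rewrite (upd_other _ _ (i := t)) 1?eq_sym // (upd_other _ _ (i := t)) 1?eq_sym.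
Qed.

Lemma map_del (T U : Type) (f : T -> U) i v : map f (del i v) = del i (map f v).
Proof. by rewrite /del map_cat map_take map_drop. Qed.

Lemma all_del (T : Type) (p : pred T) i v : all p v -> all p (del i v).
Proof.
move=> h; rewrite /del all_cat; apply/andP; split.
- by move: h; rewrite -{1}(cat_take_drop i v) all_cat => /andP[].
- by move: h; rewrite -{1}(cat_take_drop i.+1 v) all_cat => /andP[].
Qed.

Lemma eq_map_below (s s' : nat -> nat) l d : all (ltn^~ d) l ->
  (forall j, j < d -> s' j = s j) -> map s' l = map s l.
Proof. by move=> /allP h e; apply/eq_in_map => i /h; apply: e. Qed.

Lemma sub_below l d d' : d <= d' -> all (ltn^~ d) l -> all (ltn^~ d') l.
Proof. by move=> le; apply: sub_all => i /leq_trans; apply. Qed.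

Lemma compile_exp_correct e l d s x : all (ltn^~ d) l ->
  exists2 s', exec (compile_exp e l d) s x s' x &
    s' d = eval e (map s l) /\ forall j, j < d -> s' j = s j.
Proof.
elim: e l d s => [i||e IH|a IHa e IHe|i e IH|b IHb st IHs n IHn] l d s hl /=.
- case: ltnP => hi.
    have hd : nth 0 l i < d by apply: (allP hl); apply: mem_nth.
    have [|||s' h e] := exec_copy (r := nth 0 l i) (r' := d) (t := d.+1) s x; try lia.
    exists s' => //; rewrite (nth_map 0) //; split; first by rewrite e ?upd_same //; lia.
    by move=> j hj; rewrite e ?upd_other //; lia.
  have [s' h e] := exec_clear d s x; exists s' => //.
  rewrite nth_default ?size_map // e upd_same; split=> // j hj.
  by rewrite e upd_other //; lia.
- have [s' h e] := exec_clear d s x; exists s' => //.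
  rewrite e upd_same; split=> // j hj.
  by rewrite e upd_other //; lia.
- have [s1 h1 [e1 e2]] := IH l d s hl.
  exists (upd s1 d (s1 d).+1); first exact: ExSeq h1 (ExInc _ _ _).
  by rewrite upd_same e1; split=> // j hj; rewrite upd_other ?e2 //; lia.
- have [s1 h1 [e1 e2]] := IHa l d s hl.
  have [|s2 h2 [e3 e4]] := IHe (d :: l) d.+1 s1.
    by rewrite /= ltnSn (sub_below _ hl).
  have [|s3 h3 e5] := exec_move (r := d.+1) (r' := d) s2 x; first by lia.
  exists s3; first exact: ExSeq h1 (ExSeq h2 h3).
  rewrite e5 upd_same e3 /= e1 (eq_map_below hl e2); split=> // j hj.
  by rewrite e5 !upd_other ?e4 ?e2 //; lia.
- have [|s1 h1 [e1 e2]] := IH (del i l) d s; first exact: all_del.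
  by exists s1 => //; rewrite e1 map_del.
- have [s1 h1 [e1 e2]] := IHn l d s hl.
  have [|s2 h2 [e3 e4]] := IHb l d.+1 s1; first exact: sub_below hl.
  have [s3 h3 e5] := exec_clear d.+2 s2 x.
  set F := fun k a => eval st [:: a, k & map s l].
  set B := nat_rect _ _ _.
  suff [s4 h4 [e6 e7]] : exists2 s4, exec (CWhile d (CSeq (CDec d)
                 (CSeq (compile_exp st [:: d.+1, d.+2 & l] d.+3)
                 (CSeq (c_move d.+3 d.+1) (CInc d.+2))))) s3 x s4 x &
     s4 d.+1 = B (eval n (map s l)) /\ forall j, j < d -> s4 j = s j.
    have [|s5 h5 e8] := exec_move (r := d.+1) (r' := d) s4 x; first by lia.
    exists s5; first exact: ExSeq h1 (ExSeq h2 (ExSeq h3 (ExSeq h4 h5))).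
    rewrite e8 upd_same e6; split=> // j hj.
    by rewrite e8 !upd_other ?e7 //; lia.
  (* The loop invariant: [d] holds the rounds left, [d.+2] the rounds done, [d.+1] the accumulator.
     Two counters are kept because the loop test counts down while the step function sees an
     increasing index. *)
  have {e5} : [/\ s3 d.+2 + s3 d = eval n (map s l), s3 d.+1 = B (s3 d.+2) &
      forall j, j < d -> s3 j = s j].
    split.
    + by rewrite !e5 upd_same upd_other ?e4 //; lia.
    + rewrite !e5 upd_same upd_other ?e3 /= ?(eq_map_below hl e2) //; lia.
    + by move=> j hj; rewrite e5 upd_other ?e4 ?e2 //; lia.
  elim: {h3 h2 h1}(s3 d) {-2}s3 (erefl (s3 d)) => [|m IH] {}s3 e [a1 a2 a3].
    by exists s3; [apply: ExWhileEnd | rewrite a2 -a1 e addn0].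
  set s4 := upd s3 d (s3 d).-1.
  have [|s5 h5 [b1 b2]] := IHs [:: d.+1, d.+2 & l] d.+3 s4.
    by rewrite /= (sub_below _ hl) ?andbT //; lia.
  have [|s6 h6 e6] := exec_move (r := d.+3) (r' := d.+1) s5 x; first by lia.
  set s7 := upd s6 d.+2 (s6 d.+2).+1.
  have c1 : s7 d = m.
    by rewrite /s7 upd_other ?e6 ?upd_other ?b2 /s4 ?upd_same ?e //; lia.
  have c2 : s7 d.+2 = (s3 d.+2).+1.
    by rewrite /s7 upd_same e6 !upd_other ?b2 /s4 ?upd_other //; lia.
  have c3 : s7 d.+1 = F (s3 d.+2) (s3 d.+1).
    rewrite /s7 upd_other ?e6 ?upd_same ?b1 /=; last by lia.
    rewrite /s4 upd_other ?upd_other; try lia; congr (eval _ [:: _, _ & _]).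
    apply: (@eq_map_below _ _ _ d) => // j hj; rewrite upd_other ?a3 //; lia.
  have [|s8 h8 e8] := IH s7 c1.
  - rewrite c1 c2 c3 a2; split; [by rewrite -a1 e; lia | by [] |].
    by move=> j hj; rewrite /s7 !upd_other ?e6 ?upd_other ?b2 /s4 ?upd_other ?a3 //; lia.
  exists s8 => //; apply: ExWhile h8; first by rewrite e.
  exact: ExSeq (ExDec _ _ _) (ExSeq h5 (ExSeq h6 (ExInc _ _ _))).
Qed.

(** The argument is an environment of any length, entries past its end being read as 0. There is no
    arity to maintain, and composition amounts to pushing values on the list. *)
Definition prim_rec (f : seq nat -> nat) := exists e, forall v, eval e v = f v.

(** The leading 1 protects leading zeros: strings of length [n] correspond to the numbers from
    [2 ^ n] up to [2 ^ n.+1], excluded, and 0 remains free to mean that there is no string. *)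
Definition code (x : seq bool) : nat := bin_val (true :: x).

Lemma code_rcons x b : code (rcons x b) = (code x).*2 + b.
Proof. by rewrite /code /bin_val -rcons_cons foldl_rcons. Qed.

Definition c_double := CSeq (c_clear 1)
  (CSeq (CWhile 0 (CSeq (CDec 0) (CSeq (CInc 1) (CInc 1)))) (c_move 1 0)).

Lemma exec_double s x : exists2 s', exec c_double s x s' x & s' 0 = (s 0).*2.
Proof.
have [s1 h1 e1] := exec_clear 1 s x.
suff [s2 h2 e2] : exists2 s2, exec (CWhile 0 (CSeq (CDec 0) (CSeq (CInc 1) (CInc 1)))) s1 x s2 x &
    s2 1 = s1 1 + (s1 0).*2.
  have [//|s3 h3 e3] := exec_move (r := 1) (r' := 0) s2 x.
  exists s3; first exact: ExSeq h1 (ExSeq h2 h3).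
  by rewrite e3 upd_same e2 !e1.
elim: {h1 e1}(s1 0) {-2}s1 (erefl (s1 0)) => [|n IH] {}s1 e.
  by exists s1; [apply: ExWhileEnd | rewrite e addn0].
have [|s2 h2 e2] := IH (upd (upd (upd s1 0 (s1 0).-1) 1 (s1 1).+1) 1 (s1 1).+2).
  by rewrite /upd /= e.
exists s2; last by rewrite e2 /upd /= e; lia.
apply: ExWhile h2; first by rewrite e.
apply: ExSeq (ExDec _ _ _) (ExSeq (ExInc _ _ _) _).
exact: (ExInc 1 (upd (upd s1 0 (s1 0).-1) 1 (s1 1).+1)).
Qed.

(** Horner's scheme; the initial [CInc 0] supplies the leading 1 of [code]. *)
Definition c_read_input := CSeq (CInc 0) (CRead c_double (CSeq c_double (CInc 0))).

Lemma exec_read_input x : exists2 s, exec c_read_input (fun=> 0) x s [::] & s 0 = code x.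
Proof.
suff [s h e] : exists2 s, exec (CRead c_double (CSeq c_double (CInc 0)))
    (upd (fun=> 0) 0 1) x s [::] & s 0 = foldl (fun a (b : bool) => a.*2 + b) 1 x.
  by exists s => //; apply: ExSeq (ExInc _ _ _) h.
set s0 := upd _ _ _; have <- : s0 0 = 1 by [].
elim: x s0 => [|b x IH] s0 /=; first by exists s0 => //; apply: ExReadEnd.
have [s1 h1 e1] : exists2 s1, exec (if b then CSeq c_double (CInc 0) else c_double) s0 x s1 x &
    s1 0 = (s0 0).*2 + b.
  have [s1 h1 e1] := exec_double s0 x.
  case: b; last by exists s1; rewrite ?addn0.
  exists (upd s1 0 (s1 0).+1); first exact: ExSeq h1 (ExInc _ _ _).
  by rewrite upd_same e1 addn1.
have [s2 h2 e2] := IH s1.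
by exists s2; [apply: ExRead h1 h2 | rewrite e2 e1].
Qed.

(** The bridge from arithmetic to machines: from here on a language is shown computable by
    exhibiting a primitive recursive predicate on codes. *)
Lemma prim_rec_computable (P : nat -> bool) :
  prim_rec (fun v => P (nth 0 v 0)) -> computable (fun x => P (code x)).
Proof.
case=> e he; apply: (@exec_decides (CSeq c_read_input
  (CSeq (compile_exp e [:: 0] 1) (c_move 1 0)))) => x.
have [s1 h1 e1] := exec_read_input x.
have [//|s2 h2 [e2 _]] := @compile_exp_correct e [:: 0] 1 s1 [::].
have [//|s3 h3 e3] := exec_move (r := 1) (r' := 0) s2 [::].
exists s3, [::]; split; first exact: ExSeq h1 (ExSeq h2 h3).
by rewrite e3 upd_same e2 he /= e1; case: (P _).
Qed.

Lemma prim_ext f g : prim_rec f -> f =1 g -> prim_rec g.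
Proof. by case=> e he fg; exists e => v; rewrite he. Qed.

Lemma prim_var i : prim_rec (fun v => nth 0 v i).
Proof. by exists (Var i). Qed.

Lemma prim_var1 i : prim_rec (fun v => nth 0 (behead v) i).
Proof. by apply: prim_ext (prim_var i.+1) _ => v; rewrite nth_behead. Qed.

Lemma prim_var2 i : prim_rec (fun v => nth 0 (behead (behead v)) i).
Proof. by apply: prim_ext (prim_var i.+2) _ => v; rewrite !nth_behead. Qed.

Lemma prim_succ f : prim_rec f -> prim_rec (fun v => (f v).+1).
Proof. by case=> e he; exists (Succ e) => v /=; rewrite he. Qed.

Lemma prim_const n : prim_rec (fun=> n).
Proof. by elim: n => [|n]; [exists Zero | apply: prim_succ]. Qed.

Lemma prim_let f a : prim_rec f -> prim_rec a -> prim_rec (fun v => f (a v :: v)).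
Proof. by case=> e he [e' he']; exists (Let e' e) => v /=; rewrite he' he. Qed.

Lemma prim_del i f : prim_rec f -> prim_rec (fun v => f (del i v)).
Proof. by case=> e he; exists (Drp i e) => v /=; rewrite he. Qed.

Lemma prim_behead f : prim_rec f -> prim_rec (fun v => f (behead v)).
Proof. by move=> /(prim_del 0) h; apply: prim_ext h _ => v; rewrite /del take0 drop1. Qed.

Lemma prim_app1 (F : nat -> nat) a :
  prim_rec (fun v => F (nth 0 v 0)) -> prim_rec a -> prim_rec (fun v => F (a v)).
Proof. by move=> hF ha; apply: prim_let hF ha. Qed.

Lemma prim_app2 (F : nat -> nat -> nat) a b :
  prim_rec (fun v => F (nth 0 v 0) (nth 0 v 1)) ->
  prim_rec a -> prim_rec b -> prim_rec (fun v => F (a v) (b v)).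
Proof. by move=> hF /prim_behead ha hb; apply: prim_let (prim_let hF ha) hb. Qed.

Lemma prim_app3 (F : nat -> nat -> nat -> nat) a b c :
  prim_rec (fun v => F (nth 0 v 0) (nth 0 v 1) (nth 0 v 2)) ->
  prim_rec a -> prim_rec b -> prim_rec c -> prim_rec (fun v => F (a v) (b v) (c v)).
Proof.
move=> hF /prim_behead/prim_behead ha /prim_behead hb hc.
exact: prim_let (prim_let (prim_let hF ha) hb) hc.
Qed.

Lemma prim_nat_rect (G : nat -> nat -> seq nat -> nat) b n :
  prim_rec (fun w => G (nth 0 w 1) (nth 0 w 0) (behead (behead w))) ->
  prim_rec b -> prim_rec n ->
  prim_rec (fun v => nat_rect (fun=> nat) (b v) (fun k a => G k a v) (n v)).
Proof.
case=> eG hG [eb hb] [en hn]; exists (Rec eb eG en) => v /=; rewrite hb hn.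
by elim: (n v) => //= k ->; rewrite hG.
Qed.

Lemma prim_iter (G : nat -> seq nat -> nat) b n :
  prim_rec (fun w => G (nth 0 w 0) (behead w)) ->
  prim_rec b -> prim_rec n ->
  prim_rec (fun v => iter (n v) (fun a => G a v) (b v)).
Proof.
move=> /(prim_del 1) hG hb hn.
apply: prim_ext (prim_nat_rect (G := fun k a v => G a v) _ hb hn) _.
  apply: prim_ext hG _ => -[|a [|k v]]; by rewrite /del //= drop0.
by move=> v; elim: (n v) => //= k ->.
Qed.

Lemma prim_add f g : prim_rec f -> prim_rec g -> prim_rec (fun v => f v + g v).
Proof.
move=> hf hg; apply: prim_ext (prim_iter (G := fun a _ => a.+1) _ hf hg) _.
  by apply/prim_succ/prim_var.
by move=> v; elim: (g v) => [|k IH] /=; rewrite ?addn0 // IH addnS.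
Qed.

Lemma prim_mul f g : prim_rec f -> prim_rec g -> prim_rec (fun v => f v * g v).
Proof.
apply: prim_app2.
apply: prim_ext (prim_iter (G := fun a v => nth 0 v 0 + a) _ (prim_const 0) (prim_var 1)) _.
  by apply: prim_add; [apply: prim_var1 | apply: prim_var].
by move=> v; elim: (nth 0 v 1) => [|k IH] /=; rewrite ?muln0 // IH mulnS.
Qed.

Lemma prim_exp f g : prim_rec f -> prim_rec g -> prim_rec (fun v => f v ^ g v).
Proof.
apply: prim_app2.
apply: prim_ext (prim_iter (G := fun a v => nth 0 v 0 * a) _ (prim_const 1) (prim_var 1)) _.
  by apply: prim_mul; [apply: prim_var1 | apply: prim_var].
by move=> v; elim: (nth 0 v 1) => [|k IH] //=; rewrite IH expnS.
Qed.

Lemma prim_pred f : prim_rec f -> prim_rec (fun v => (f v).-1).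
Proof.
move=> hf.
apply: prim_ext (prim_nat_rect (G := fun k _ _ => k) (prim_var 1) (prim_const 0) hf) _.
by move=> v; case: (f v).
Qed.

Lemma prim_sub f g : prim_rec f -> prim_rec g -> prim_rec (fun v => f v - g v).
Proof.
move=> hf hg; apply: prim_ext (prim_iter (G := fun a _ => a.-1) _ hf hg) _.
  by apply/prim_pred/prim_var.
by move=> v; elim: (g v) => [|k IH] /=; rewrite ?subn0 // IH subnS.
Qed.

Lemma prim_leq f g : prim_rec f -> prim_rec g -> prim_rec (fun v => (f v <= g v) : nat).
Proof.
move=> hf hg; apply: prim_ext (prim_sub (prim_const 1) (prim_sub hf hg)) _ => v.
by rewrite -subn_eq0; case: (f v - g v).
Qed.

Lemma prim_and (b c : seq nat -> bool) : prim_rec b -> prim_rec c ->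
  prim_rec (fun v => (b v && c v) : nat).
Proof.
by move=> hb hc; apply: prim_ext (prim_mul hb hc) _ => v; case: (b v); case: (c v).
Qed.

Lemma prim_neg (b : seq nat -> bool) : prim_rec b -> prim_rec (fun v => (~~ b v) : nat).
Proof.
by move=> hb; apply: prim_ext (prim_sub (prim_const 1) hb) _ => v; case: (b v).
Qed.

Lemma prim_eq f g : prim_rec f -> prim_rec g -> prim_rec (fun v => (f v == g v) : nat).
Proof.
move=> hf hg; apply: prim_ext (prim_and (prim_leq hf hg) (prim_leq hg hf)) _ => v.
by rewrite -eqn_leq.
Qed.

Lemma prim_if (b : seq nat -> bool) f g : prim_rec b -> prim_rec f -> prim_rec g ->
  prim_rec (fun v => if b v then f v else g v).
Proof.
move=> hb hf hg.
apply: prim_ext (prim_add (prim_mul hb hf) (prim_mul (prim_neg hb) hg)) _ => v.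
by case: (b v); rewrite /= ?mul0n ?mul1n ?addn0.
Qed.

Lemma prim_sum (F : nat -> seq nat -> nat) n :
  prim_rec (fun w => F (nth 0 w 0) (behead w)) -> prim_rec n ->
  prim_rec (fun v => \sum_(0 <= i < n v) F i v).
Proof.
move=> /prim_behead hF hn.
apply: prim_ext (prim_nat_rect (G := fun k a v => a + F k v) _ (prim_const 0) hn) _.
  apply: prim_add (prim_var 0) _; apply: prim_ext hF _ => v.
  by rewrite nth_behead.
by move=> v; elim: (n v) => [|k IH] /=; rewrite ?big_nil // big_nat_recr //= IH.
Qed.

Lemma prim_has (P : nat -> seq nat -> bool) n :
  prim_rec (fun w => P (nth 0 w 0) (behead w)) -> prim_rec n ->
  prim_rec (fun v => has (P ^~ v) (iota 0 (n v)) : nat).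
Proof.
move=> hP hn; apply: prim_ext (prim_leq (prim_const 1) (prim_sum hP hn)) _ => v.
congr nat_of_bool; rewrite has_count /index_iota subn0; congr (0 < _).
by elim: (iota 0 (n v)) => [|i l IH]; rewrite ?big_nil // big_cons /= IH.
Qed.

Ltac prim_user := fail.
Ltac prim := repeat first
  [ prim_user | apply: prim_const | apply: prim_var | apply: prim_var1 | apply: prim_var2
  | assumption
  | apply: prim_succ | apply: prim_exp | apply: prim_mul | apply: prim_add | apply: prim_pred
  | apply: prim_sub | apply: prim_leq | apply: prim_and | apply: prim_neg | apply: prim_eq
  | apply: prim_if ].

(** Quotients and logarithms are obtained below as the number of [k] that satisfy an inequality
    equivalent to [k < q]. *)
Lemma sum_ltn n q : \sum_(0 <= k < n) (k < q) = minn n q.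
Proof.
elim: n => [|n IH]; first by rewrite big_nil min0n.
by rewrite big_nat_recr //= IH; lia.
Qed.

Lemma prim_div f g : prim_rec f -> prim_rec g -> prim_rec (fun v => f v %/ g v).
Proof.
apply: prim_app2.
have hF : prim_rec (fun w => (nth 0 w 0).+1 * nth 0 (behead w) 1 <= nth 0 (behead w) 0).
  by prim.
have h := prim_sum (F := fun k v => k.+1 * nth 0 v 1 <= nth 0 v 0) hF (prim_var 0).
(* For divisor 0 the count would be the whole dividend, whereas [%/] gives 0. *)
apply: prim_ext (prim_if (b := fun v => nth 0 v 1 == 0) _ (prim_const 0) h) _; first by prim.
move=> v; set c := nth 0 v 0; set d := nth 0 v 1.
case: (posnP d) => [->|d0]; first by rewrite divn0.
under eq_bigr do rewrite -leq_divRL //.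
by rewrite sum_ltn; apply/minn_idPr/leq_div.
Qed.

Lemma prim_dvd f g : prim_rec f -> prim_rec g -> prim_rec (fun v => (f v %| g v) : nat).
Proof.
move=> hf hg; have h : prim_rec (fun v => g v %/ f v) by apply: prim_div.
by apply: prim_ext (prim_eq (prim_mul h hf) hg) _ => v; rewrite dvdn_eq.
Qed.

Lemma prim_odd f : prim_rec f -> prim_rec (fun v => odd (f v) : nat).
Proof.
move=> hf; apply: prim_ext (prim_neg (prim_dvd (prim_const 2) hf)) _ => v.
by rewrite dvdn2 negbK.
Qed.

Lemma prim_log f : prim_rec f -> prim_rec (fun v => trunc_log 2 (f v)).
Proof.
apply: (prim_app1 (F := trunc_log 2)).
have hF : prim_rec (fun w => 2 ^ (nth 0 w 0).+1 <= nth 0 (behead w) 0) by prim.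
apply: prim_ext (prim_sum (F := fun k v => 2 ^ k.+1 <= nth 0 v 0) hF (prim_var 0)) _.
move=> v; case: (posnP (nth 0 v 0)) => [->|c0]; first by rewrite big_nil.
have e k : (2 ^ k.+1 <= nth 0 v 0) = (k < trunc_log 2 (nth 0 v 0)).
  apply/idP/idP => [|h]; first exact: trunc_log_max.
  by apply: leq_trans (trunc_logP (isT : 1 < 2) c0); rewrite leq_exp2l.
under eq_bigr do rewrite e.
rewrite sum_ltn; apply/minn_idPr/ltnW; apply: leq_trans (trunc_logP (isT : 1 < 2) c0).
exact: ltn_expl.
Qed.

Lemma prim_logn p f : prime p -> prim_rec f -> prim_rec (fun v => logn p (f v)).
Proof.
move=> pp; apply: (prim_app1 (F := logn p)).
have hF : prim_rec (fun w => p ^ (nth 0 w 0).+1 %| nth 0 (behead w) 0).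
  by apply: prim_dvd; prim.
apply: prim_ext (prim_sum (F := fun k v => p ^ k.+1 %| nth 0 v 0) hF (prim_pred (prim_var 0))) _.
by move=> v; rewrite logn_count_dvd // big_add1.
Qed.

(** * A universal simulator *)

(** The projections become valuations, which are primitive recursive and send 0 to 0. Moreover
    [pairn a b] exceeds [b], so a length that codes a machine and an exponent is larger than the
    exponent. The size of codes is of no concern. *)
Definition pairn a b := 2 ^ a * 3 ^ b.
Definition fstn := logn 2.
Definition sndn := logn 3.

Lemma fst_pairn a b : fstn (pairn a b) = a.
Proof. by rewrite /fstn /pairn lognM ?expn_gt0 // !lognX /= muln1 muln0 addn0. Qed.

Lemma snd_pairn a b : sndn (pairn a b) = b.
Proof. by rewrite /sndn /pairn lognM ?expn_gt0 // !lognX /= muln1 muln0. Qed.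

(* [0] codes the empty list, and reading past the end of a list gives [0]. *)
Definition nthn l i := fstn (iter i sndn l).

Lemma nthn0 l : nthn l 0 = fstn l. Proof. by []. Qed.

Lemma nthnS l i : nthn l i.+1 = nthn (sndn l) i.
Proof. by rewrite /nthn iterSr. Qed.

Definition list_code (l : seq nat) := foldr pairn 0 l.

Lemma nthn_list_code l i : nthn (list_code l) i = nth 0 l i.
Proof.
elim: l i => [|a l IH] i; first by rewrite nth_nil; elim: i => //= i; rewrite nthnS.
by case: i => [|i] /=; rewrite ?nthn0 ?nthnS ?fst_pairn // snd_pairn IH.
Qed.

(** [c] codes state, head symbol, left tape and right tape; [t] is the table entry. Halting and
    queries have no case of their own, being built into the table by [eff_trans]. *)
Definition sim_step e c :=
  let h := fstn (sndn c) in
  let l := fstn (sndn (sndn c)) in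
  let r := sndn (sndn (sndn c)) in
  let t := nthn (nthn (fstn e) (fstn c)) h in
  let s := fstn (sndn t) in
  let m := sndn (sndn t) in
  pairn (fstn t)
    (if m == 0 then pairn s (pairn l r)
     else if m == 1 then pairn (fstn l) (pairn (sndn l) (pairn s r))
     else pairn (fstn r) (pairn (pairn s l) (sndn r))).

Definition start_field e := fstn (sndn e).
Definition rej_field e := fstn (sndn (sndn e)).
Definition bit_field e (b : bool) :=
  if b then sndn (sndn (sndn (sndn e))) else fstn (sndn (sndn (sndn e))).

(** The list is built from its end: binary digit [j] of [c] is the letter at distance [j] from the
    end of the word. *)
Definition word_code e c n :=
  nat_rect (fun=> nat) 0 (fun j a => pairn (bit_field e (odd (c %/ 2 ^ j))) a) n.

Definition sim_init e c n :=
  let w := word_code e c n in pairn (start_field e) (pairn (fstn w) (pairn 0 (sndn w))).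

Definition sim e c n t := iter t (sim_step e) (sim_init e c n).

Lemma odd_code_div x j : j < size x -> odd (code x %/ 2 ^ j) = nth false (rev x) j.
Proof.
elim/last_ind: x j => [//|x b IH] j; rewrite size_rcons code_rcons rev_rcons.
case: j => [|j] /= h; first by rewrite divn1 oddD odd_double oddb.
rewrite expnS divnMA -IH //; congr (odd (_ %/ _)).
by rewrite divn2 halfD odd_double /= doubleK; case: b; rewrite /= addn0.
Qed.

Section Coding.
Variable M : OTM.

(** The blank is put first so that it has index 0, the value read past the end of a coded list. Tape
    codes are thus padded with blanks for free. *)
Definition symbs := blank M :: enum (symb M).
Definition symb_code (a : symb M) := index a symbs.
Definition state_code (q : state M) := index q (enum (state M)).
Definition move_code (m : move) := match m with Stay => 0 | MoveL => 1 | MoveR => 2 end.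

(** A halted configuration stays as it is, and under the empty oracle every query leads to [q_no].
    Both become ordinary transitions, and the content of the query tape can be forgotten. *)
Definition eff_trans (q : state M) (a : symb M) : state M * symb M * move * qact :=
  if (q == q_acc M) || (q == q_rej M) then (q, a, Stay, QNop)
  else if q == q_query M then (q_no M, a, Stay, QNop) else trans M q a.

Definition entry q a :=
  let: (q', s, m, _) := eff_trans q a in
  pairn (state_code q') (pairn (symb_code s) (move_code m)).

Definition table :=
  list_code [seq list_code [seq entry q a | a <- symbs] | q <- enum (state M)].

Definition machine_code :=
  pairn table (pairn (state_code (q_start M)) (pairn (state_code (q_rej M))
    (pairn (symb_code (bit0 M)) (symb_code (bit1 M))))).

Lemma mem_symbs a : a \in symbs. Proof. by rewrite in_cons mem_enum orbT. Qed.

Lemma table_entry q a : nthn (nthn table (state_code q)) (symb_code a) = entry q a.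
Proof.
rewrite nthn_list_code (nth_map q) ?index_mem ?mem_enum // nth_index ?mem_enum //.
by rewrite nthn_list_code (nth_map a) ?index_mem ?mem_symbs // nth_index ?mem_symbs.
Qed.

Lemma state_code_inj : injective state_code.
Proof. by move=> q q'; apply: (index_inj q); rewrite mem_enum. Qed.

Definition codes_tape (l : seq (symb M)) n :=
  forall i, nthn n i = symb_code (nth (blank M) l i).

Definition codes_config (c : config M) n := exists l r,
  [/\ n = pairn (state_code (c_state c)) (pairn (symb_code (c_head c)) (pairn l r)),
      codes_tape (c_left c) l & codes_tape (c_right c) r].

Lemma codes_tape_nil : codes_tape [::] 0.
Proof.
move=> i; rewrite nth_nil /symb_code /= eqxx.
by elim: i => //= i; rewrite nthnS.
Qed.

Lemma codes_tape_cons a l n : codes_tape l n -> codes_tape (a :: l) (pairn (symb_code a) n).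
Proof. by move=> h [|i]; rewrite ?nthn0 ?nthnS ?fst_pairn ?snd_pairn //= h. Qed.

Lemma codes_tape_head l n : codes_tape l n -> fstn n = symb_code (head (blank M) l).
Proof. by move/(_ 0); rewrite nthn0 nth0. Qed.

Lemma codes_tape_behead l n : codes_tape l n -> codes_tape (behead l) (sndn n).
Proof. by move=> h i; rewrite -nthnS h nth_behead. Qed.

Lemma step_eff_trans c : exists w,
  step M empty_oracle c =
  (let: (q', s, m, _) := eff_trans (c_state c) (c_head c) in
   let: (l', h', r') := move_tape (c_left c) s (c_right c) m in Config q' l' h' r' w).
Proof.
rewrite /step /halted /eff_trans; case: c => q l h r w /=.
case: ifP => _; first by exists w.
case: ifP => _; first by exists [::].
by case: (trans _ _ _) => [[[q' a] m] k]; eexists; case: (move_tape _ _ _ _) => [[? ?] ?].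
Qed.

Lemma sim_stepP c n : codes_config c n ->
  codes_config (step M empty_oracle c) (sim_step machine_code n).
Proof.
move=> [l [r [-> hl hr]]]; have [w ->] := step_eff_trans c.
rewrite /sim_step !(fst_pairn, snd_pairn) table_entry /entry.
case: (eff_trans _ _) => [[[q a] m] _]; rewrite !(fst_pairn, snd_pairn).
case: m => /=.
- rewrite (codes_tape_head hl); have := codes_tape_behead hl.
  case: (c_left c) => [|b s] /= hb; exists (sndn l), (pairn (symb_code a) r);
  by split=> //; apply: codes_tape_cons.
- rewrite (codes_tape_head hr); have := codes_tape_behead hr.
  case: (c_right c) => [|b s] /= hb; exists (pairn (symb_code a) l), (sndn r);
  by split=> //; apply: codes_tape_cons.
- by exists l, r.
Qed.

Lemma word_codeP x :
  codes_tape (map (enc_bit M) x) (word_code machine_code (code x) (size x)).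
Proof.
have hb b : bit_field machine_code b = symb_code (enc_bit M b).
  by rewrite /bit_field /machine_code !(fst_pairn, snd_pairn); case: b.
suff h j : j <= size x -> codes_tape (map (enc_bit M) (rev (take j (rev x))))
    (word_code machine_code (code x) j).
  by have := h _ (leqnn _); rewrite take_oversize ?size_rev // revK.
elim: j => [|j IH] hj; first by rewrite take0; apply: codes_tape_nil.
rewrite (take_nth false) ?size_rev // rev_rcons /= odd_code_div // hb.
by apply/codes_tape_cons/IH/ltnW.
Qed.

Lemma sim_initP x : codes_config (init M x) (sim_init machine_code (code x) (size x)).
Proof.
have hw := word_codeP x; exists 0, (sndn (word_code machine_code (code x) (size x))).
rewrite /sim_init (codes_tape_head hw) /start_field !(fst_pairn, snd_pairn).
have := codes_tape_behead hw.
by case: x {hw} => [|b x] /= hb; split=> //; apply: codes_tape_nil.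
Qed.

Lemma simP x t : fstn (sim machine_code (code x) (size x) t) =
  state_code (c_state (run M empty_oracle x t)).
Proof.
suff [l [r [-> _ _]]] : codes_config (run M empty_oracle x t)
    (sim machine_code (code x) (size x) t) by rewrite fst_pairn.
by elim: t => [|t IH]; [apply: sim_initP | apply: sim_stepP].
Qed.

End Coding.

(* At length [n] the candidate machine is [fstn n], with time bound [n ^ sndn n]: each machine
   is tried at infinitely many lengths, with a bound exceeding any given polynomial. *)
Definition rejects n c := fstn (sim (fstn n) c n (n ^ sndn n)) == rej_field (fstn n).

Definition search n m := nat_rect (fun=> nat) 0
  (fun d a => if a != 0 then a else if rejects n (2 ^ n + d) then 2 ^ n + d else 0) m.

Definition diag n := search n (2 ^ n).

Lemma searchP n m : if search n m == 0 then forall d, d < m -> ~~ rejects n (2 ^ n + d)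
  else exists2 d, d < m & search n m = 2 ^ n + d /\ rejects n (2 ^ n + d).
Proof.
have n0 d : (2 ^ n + d == 0) = false by rewrite addn_eq0 expn_eq0.
elim: m => [//|m]; rewrite [search n m.+1]/=.
case: eqP => [-> h|/eqP ne [d hd h]] /=; last first.
  by rewrite (negbTE ne); exists d => //; apply: ltnW.
case: (boolP (rejects n (2 ^ n + m))) => hm; first by rewrite n0; exists m.
by move=> d; rewrite ltnS leq_eqVlt => /predU1P[->|/h //]; exact: hm.
Qed.

Lemma diagP n : if diag n == 0 then forall c, 2 ^ n <= c < 2 ^ n.+1 -> ~~ rejects n c
  else 2 ^ n <= diag n < 2 ^ n.+1 /\ rejects n (diag n).
Proof.
have := searchP n (2 ^ n); rewrite -/(diag n); case: eqP => _ h.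
  move=> c hc; have := h (c - 2 ^ n); rewrite subnKC; last by lia.
  by apply; move: hc; rewrite expnS; lia.
have [d hd [-> hr]] := h; split=> //; rewrite expnS; lia.
Qed.

(** * The simulator and the diagonal search are primitive recursive *)

Lemma prim_fst f : prim_rec f -> prim_rec (fun v => fstn (f v)).
Proof. exact: prim_logn. Qed.

Lemma prim_snd f : prim_rec f -> prim_rec (fun v => sndn (f v)).
Proof. exact: prim_logn. Qed.

Ltac prim_user ::= first
  [ apply: prim_fst | apply: prim_snd | apply: prim_div | apply: prim_odd | apply: prim_log ].

Lemma prim_pair f g : prim_rec f -> prim_rec g -> prim_rec (fun v => pairn (f v) (g v)).
Proof. by move=> hf hg; rewrite /pairn; prim. Qed.

Lemma prim_nthn f g : prim_rec f -> prim_rec g -> prim_rec (fun v => nthn (f v) (g v)).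
Proof.
move=> hf hg; rewrite /nthn; apply: prim_fst.
apply: (prim_iter (G := fun a _ => sndn a)) => //; prim.
Qed.

Ltac prim_user ::= first
  [ apply: prim_nthn | apply: prim_pair | apply: prim_fst | apply: prim_snd | apply: prim_div
  | apply: prim_odd | apply: prim_log ].

Lemma prim_sim_step f g : prim_rec f -> prim_rec g ->
  prim_rec (fun v => sim_step (f v) (g v)).
Proof. by move=> hf hg; rewrite /sim_step; prim. Qed.

Lemma prim_word_code f g h : prim_rec f -> prim_rec g -> prim_rec h ->
  prim_rec (fun v => word_code (f v) (g v) (h v)).
Proof.
apply: prim_app3.
apply: (prim_nat_rect
  (G := fun j a v => pairn (bit_field (nth 0 v 0) (odd (nth 0 v 1 %/ 2 ^ j))) a)).
- by rewrite /bit_field; prim.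
- by prim.
- by prim.
Qed.

Lemma prim_sim f g h k : prim_rec f -> prim_rec g -> prim_rec h -> prim_rec k ->
  prim_rec (fun v => sim (f v) (g v) (h v) (k v)).
Proof.
move=> hf hg hh hk; rewrite /sim.
apply: (prim_iter (G := fun a v => sim_step (f v) a)) => //.
  by apply: prim_sim_step; [apply: prim_behead | prim].
have hw := prim_word_code hf hg hh.
by rewrite /sim_init /start_field; prim.
Qed.

Lemma prim_rejects f g : prim_rec f -> prim_rec g ->
  prim_rec (fun v => rejects (f v) (g v) : nat).
Proof.
move=> hf hg; rewrite /rejects /rej_field; apply: prim_eq; last by prim.
by apply: prim_fst; apply: prim_sim; prim.
Qed.

Lemma prim_diag f : prim_rec f -> prim_rec (fun v => diag (f v)).
Proof.
apply: prim_app1; rewrite /diag /search.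
apply: (prim_nat_rect (G := fun d a v => if a != 0 then a else
  if rejects (nth 0 v 0) (2 ^ nth 0 v 0 + d) then 2 ^ nth 0 v 0 + d else 0)).
- by apply: prim_if; last apply: prim_if; try apply: prim_rejects; prim.
- by prim.
- by prim.
Qed.

(** * Deciding quickly on the prefixes of the oracle *)

(* Successor in length-lexicographic order, on reversed strings. *)
Fixpoint lex_succ (l : seq bool) : seq bool :=
  match l with
  | [::] => [:: false]
  | true :: l' => false :: lex_succ l'
  | false :: l' => true :: l'
  end.

(** With the leading 1 of [code] as an implicit top digit, [lex_succ] is binary increment: a carry
    out of an all-ones string turns that 1 into 10, so one more zero appears. *)
Lemma code_lex_succ l : code (rev (lex_succ l)) = (code (rev l)).+1.
Proof.
elim: l => [|[] l IH] //=; rewrite !rev_cons !code_rcons; last by rewrite addn0 addn1.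
by rewrite IH; lia.
Qed.

Definition counter v := iter v lex_succ [::].

Lemma str_index_counter v : str_index (rev (counter v)) = v.
Proof.
suff : code (rev (counter v)) = v.+1 by rewrite /str_index -/(code _) => ->.
by elim: v => //= v IH; rewrite code_lex_succ IH.
Qed.

Lemma size_counter v : size (counter v) <= v.
Proof.
have h l : size (lex_succ l) <= (size l).+1 by elim: l => [|[] l IH].
by elim: v => //= v IH; apply: leq_trans (h _) _.
Qed.

Definition cell_of (l : seq bool) i := nth None (map Some l) i.

Lemma cell_lex_succ l i : cell_of (lex_succ l) i =
  if i < index false l then Some false
  else if i == index false l then Some (index false l < size l) else cell_of l i.
Proof.
elim: l i => [|[] l IH] [|i] //=; rewrite /cell_of /= ?nth_nil //.
by rewrite -/(cell_of _ _) IH !ltnS eqSS.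
Qed.

Lemma cell_index l i : i < index false l -> cell_of l i = Some true.
Proof.
move=> h; have := before_find false h.
rewrite /cell_of (nth_map false); first by case: (nth _ _ _).
exact: leq_trans h (find_size _ _).
Qed.

(** One round: [PUp] runs to the end of the counter, [PDown] copies it to the query tape on the way
    back, [PQuery] asks, [PYes] or [PNo] carries the answer to the first unvisited input cell. On
    agreement [PBack] returns, [PSucc] increments the counter and [PReturn] returns again; on
    disagreement [PFail] returns and starts [D]. *)
Inductive phase :=
  | PInit | PUp | PDown | PQuery | PYes | PNo | PBack | PSucc | PReturn | PFail | PAcc | PRej.

Definition phase_rank (p : phase) : 'I_12 :=
  let i k hk := @Ordinal 12 k hk in
  match p with
  | PInit => i 0 isT | PUp => i 1 isT | PDown => i 2 isT | PQuery => i 3 isT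
  | PYes => i 4 isT | PNo => i 5 isT | PBack => i 6 isT | PSucc => i 7 isT
  | PReturn => i 8 isT | PFail => i 9 isT | PAcc => i 10 isT | PRej => i 11 isT
  end.

Definition phase_unrank (i : 'I_12) : phase :=
  nth PInit [:: PInit; PUp; PDown; PQuery; PYes; PNo; PBack; PSucc; PReturn; PFail; PAcc; PRej] i.

Lemma phase_rankK : cancel phase_rank phase_unrank.
Proof. by case. Qed.

HB.instance Definition _ := Equality.copy phase (can_type phase_rankK).
HB.instance Definition _ := Choice.copy phase (can_type phase_rankK).
HB.instance Definition _ := Countable.copy phase (can_type phase_rankK).
HB.instance Definition _ := Finite.copy phase (can_type phase_rankK).

Section PrefixMachine.
Variable D : OTM.

Definition psymb : finType := ((symb D * (option bool * bool)) * (bool * option bool))%type.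
Definition pstate : finType := (phase + state D)%type.

(* A cell carries a symbol of [D], an input bit with a "visited" mark, a left-end flag and a
   bit of the counter, which is the reversal of the string to be queried next. *)
Definition psym (a : symb D) (i : option bool) (vis flag : bool) (k : option bool) : psymb :=
  ((a, (i, vis)), (flag, k)).

Definition ptrans (q : pstate) (a : psymb) : pstate * psymb * move * qact :=
  let: ((w, (i, vis)), (flag, k)) := a in
  let back r := if flag then (r, a, Stay, QNop) else (q, a, MoveL, QNop) in
  let compare b :=
    if vis then (q, a, MoveR, QNop) else
    match i with
    | None => (inl PRej, a, Stay, QNop)
    | Some c =>
        if c == b then (inl PBack, psym w i true flag k, Stay, QNop)
        else (inl PFail, a, Stay, QNop)
    end in
  match q with
  | inl PInit => (inl PUp, psym w i vis true k, Stay, QNop)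
  | inl PUp =>
      if k is Some _ then (q, a, MoveR, QNop) else
      if flag then (inl PQuery, a, Stay, QNop) else (inl PDown, a, MoveL, QNop)
  | inl PDown =>
      let p := if k is Some b then QPush b else QNop in
      if flag then (inl PQuery, a, Stay, p) else (q, a, MoveL, p)
  | inl PYes => compare true
  | inl PNo => compare false
  | inl PBack => back (inl PSucc)
  | inl PSucc =>
      match k with
      | Some true => (q, psym w i vis flag (Some false), MoveR, QNop)
      | Some false => (inl PReturn, psym w i vis flag (Some true), Stay, QNop)
      | None => (inl PReturn, psym w i vis flag (Some false), Stay, QNop)
      end
  | inl PReturn => back (inl PUp)
  | inl PFail => back (inr (q_start D))
  | inl _ => (q, a, Stay, QNop)
  | inr r =>
      if r == q_acc D then (inl PAcc, a, Stay, QNop) else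
      if r == q_rej D then (inl PRej, a, Stay, QNop) else
      if r == q_query D then (inr (q_no D), a, Stay, QNop) else
      let: (r', w', m, _) := trans D r w in
      (inr r', ((w', (i, vis)), (flag, k)), m, QNop)
  end.

Definition pmachine : OTM := {|
  state := pstate; symb := psymb; blank := psym (blank D) None false false None;
  bit0 := psym (bit0 D) (Some false) false false None;
  bit1 := psym (bit1 D) (Some true) false false None;
  q_start := inl PInit; q_acc := inl PAcc; q_rej := inl PRej;
  q_query := inl PQuery; q_yes := inl PYes; q_no := inl PNo; trans := ptrans |}.

Definition ptape (x : seq bool) (v : nat) (l : seq bool) : nat -> symb pmachine :=
  fun i => psym (tape_of D x i) (cell_of x i) (i < v) (i == 0) (cell_of l i).

Variable X : oracle.
Notation reach := (@reach pmachine X).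
Notation st p := (inl p : state pmachine).

Lemma upd_ptape x v l p i : upd (ptape x v l) p (ptape x v l p) i = ptape x v l i.
Proof. by rewrite /upd; case: eqP => // ->. Qed.

Lemma cell_of_lt l i : i < size l -> cell_of l i = Some (nth false l i).
Proof. by move=> h; rewrite /cell_of (nth_map false). Qed.

Lemma cell_of_ge l i : size l <= i -> cell_of l i = None.
Proof. by move=> h; rewrite /cell_of nth_default // size_map. Qed.

Lemma tape_of_pmachine x i : tape_of pmachine x i =
  psym (tape_of D x i) (cell_of x i) false false None.
Proof.
rewrite /tape_of; case: (ltnP i (size x)) => h; last first.
  by rewrite !nth_default ?size_map // cell_of_ge.
by rewrite !(nth_map false) // cell_of_lt // /enc_bit; case: (nth _ _ _).
Qed.

Lemma prefix_init x : exists2 c, reach 1 (init pmachine x) c &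
  represents c (st PUp) 0 (ptape x 0 [::]) [::].
Proof.
have := represents_trans X (represents_init pmachine x).
rewrite tape_of_pmachine => /(_ isT isT)[c r h]; exists c => //.
apply: represents_ext h => i; rewrite /upd /ptape /cell_of nth_nil.
by case: eqP => [->|/eqP/negbTE ne] //; rewrite tape_of_pmachine.
Qed.

Lemma return_step c p q q' x v l w :
  represents c q p (ptape x v l) w -> ~~ special q ->
  (forall a : psymb, trans pmachine q a =
     if a.2.1 then (q', a, Stay, QNop) else (q, a, MoveL, QNop)) ->
  exists2 c', reach p.+1 c c' & represents c' q' 0 (ptape x v l) w.
Proof.
move=> h ns hq.
have [|c1 r1 h1] := represents_return X h ns.
  by move=> [|i] // _; rewrite hq.
have := represents_trans X h1 ns; rewrite hq /= => /(_ isT)[c2 r2 h2].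
exists c2; first by rewrite -addn1; apply: reach_trans r1 r2.
by apply: represents_ext h2 => i; apply: upd_ptape.
Qed.

Lemma query_counter c x v l :
  represents c (st PUp) 0 (ptape x v l) [::] ->
  exists n c', [/\ n <= (size l).*2.+2, reach n c c' &
    represents c' (st (if X (str_index (rev l)) then PYes else PNo)) 0 (ptape x v l) [::]].
Proof.
move=> h.
have [n [c1 [hn r1 h1]]] : exists n c1, [/\ n <= (size l).*2.+1, reach n c c1 &
    represents c1 (st PQuery) 0 (ptape x v l) l].
  case: l h => [|b l] h.
    have := represents_trans X h isT.
    rewrite /= => /(_ isT)[c1 r1 h1]; exists 1, c1; split=> //.
    by apply: represents_ext h1 => i; apply: upd_ptape.
  have [|c1 r1 h1] := represents_skip_right (d := (size l).+1) X h isT.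
    by move=> i hi; rewrite /= cell_of_lt //=; lia.
  have := represents_trans X h1 isT.
  rewrite /= cell_of_ge //= => /(_ isT)[c2 r2 h2].
  have {}h2 := represents_ext (upd_ptape x v (b :: l) (0 + (size l).+1)) h2.
  (* Cell 0 is left out of this scan: on the left-end flag [PDown] pushes the last bit and passes to
     [PQuery] in one step. *)
  have [|c3 r3 h3] := represents_scan_left (k := fun i => QPush (nth false (b :: l) i)) X h2 isT.
    by move=> [|i] // hi; rewrite /= cell_of_lt //=; lia.
  have := represents_trans X h3 isT.
  rewrite /= => /(_ isT)[c4 r4 h4].
  exists ((size l).+1 + 1 + (size l) + 1), c4; split; first by rewrite /=; lia.
    by apply: reach_trans r4; apply: reach_trans r3; apply: reach_trans r1 r2.
  have {}h4 := represents_ext (upd_ptape x v (b :: l) 0) h4.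
  suff e : foldr (fun i => push (QPush (nth false (b :: l) i))) [::] (iota 1 (size l)) = l.
    by rewrite e in h4.
  transitivity [seq nth false (b :: l) i | i <- iota 1 (size l)].
    by elim: (iota _ _) => //= i s ->.
  by rewrite map_nth_iota ?drop1 ?take_size //= subn1.
have h2 := represents_query_step X h1 erefl isT.
exists (n + 1), (step pmachine X c1); split; [lia | exact: reach_trans r1 _ |].
by case: (X _) h2.
Qed.

Lemma succ_counter c x v l :
  represents c (st PSucc) 0 (ptape x v l) [::] ->
  exists n c', [/\ n <= (size l).*2.+2, reach n c c' &
    represents c' (st PUp) 0 (ptape x v (lex_succ l)) [::]].
Proof.
set j := index false l; move=> h.
have hj : j <= size l by apply: index_size.
have [|c1 r1 h1] := represents_scan_right (M := pmachine) (d := j)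
    (U := fun i => psym (tape_of D x i) (cell_of x i) (i < v) (i == 0) (Some false)) X h isT.
  by move=> i hi; rewrite /= cell_index.
have [c2 r2 h2] : exists2 c2, reach 1 c1 c2 &
    represents c2 (st PReturn) j (ptape x v (lex_succ l)) [::].
  have := represents_trans X h1 isT; rewrite !add0n /= ltnn.
  have e i : ptape x v (lex_succ l) i =
     if i < j then psym (tape_of D x i) (cell_of x i) (i < v) (i == 0) (Some false)
     else if i == j then psym (tape_of D x i) (cell_of x i) (i < v) (i == 0) (Some (j < size l))
     else ptape x v l i.
    by rewrite /ptape cell_lex_succ; case: ifP => // _; case: ifP.
  have [lt|ge] := ltnP j (size l).
    rewrite /= cell_of_lt // nth_index -?index_mem //= => /(_ isT)[c2 r2 h2].
    exists c2 => //; apply: represents_ext h2 => i.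
    by rewrite e lt /upd; case: (ltngtP i j) => // ->.
  rewrite /= cell_of_ge //= => /(_ isT)[c2 r2 h2].
  exists c2 => //; apply: represents_ext h2 => i.
  by rewrite e [j < size l]ltnNge ge /upd; case: (ltngtP i j) => // ->.
have [|c3 r3 h3] := return_step (q' := st PUp) h2 isT.
  by move=> [[w [i b]] [[] k]].
exists (j + 1 + j.+1), c3; split=> //; first by lia.
by apply: reach_trans r3; apply: reach_trans r1 r2.
Qed.

(** The counter is crossed back and forth for the query and again for the increment, the visited
    input once each way. Since the counter has at most [v] bits, this is at most [6 * v.+1] steps;
    10 leaves room. *)
Lemma prefix_round c x v :
  represents c (st PUp) 0 (ptape x v (counter v)) [::] -> v < size x ->
  exists n c', [/\ n <= 10 * v.+1, reach n c c' &
    represents c' (if X v == nth false x v then st PUp else inr (q_start D)) 0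
      (if X v == nth false x v then ptape x v.+1 (counter v.+1) else ptape x v (counter v)) [::]].
Proof.
move=> h hv; have hs := size_counter v.
have [n1 [c1 [hn1 r1 h1]]] := query_counter h; rewrite str_index_counter in h1.
have hc (a : psymb) : trans pmachine (st (if X v then PYes else PNo)) a =
    (let: ((w, (i, vis)), (flag, k)) := a in
     if vis then (st (if X v then PYes else PNo), a, MoveR, QNop) else
     match i with
     | None => (inl PRej, a, Stay, QNop)
     | Some c =>
        if c == X v then (inl PBack, psym w i true flag k, Stay, QNop)
        else (inl PFail, a, Stay, QNop)
     end).
  by case: a => [[w [i b]] [f k]]; case: (X v).
have ns : ~~ special (st (if X v then PYes else PNo)) by case: (X v).
have [|c2 r2 h2] := represents_skip_right (d := v) X h1 ns.
  by move=> i hi; rewrite hc /= ifT //; lia.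
have := represents_trans X h2 ns; rewrite add0n hc /= ltnn cell_of_lt // eq_sym.
case: eqP => [e|ne] /(_ isT)[c3 r3 h3].
- have {}h3 : represents c3 (st PBack) v (ptape x v.+1 (counter v)) [::].
    apply: represents_ext h3 => i; rewrite /upd /ptape ltnS.
    by case: (ltngtP i v) => // ->; rewrite [cell_of x v]cell_of_lt.
  have [|c4 r4 h4] := return_step (q' := st PSucc) h3 isT.
    by move=> [[w [i b]] [[] k]].
  have [n5 [c5 [hn5 r5 h5]]] := succ_counter h4.
  exists (n1 + v + 1 + v.+1 + n5), c5; split=> //; first by lia.
  by do 3 (apply: reach_trans; last by eassumption); apply: reach_trans r1 r2.
- have {}h3 := represents_ext (upd_ptape x v (counter v) v) h3.
  have [|c4 r4 h4] := return_step (q' := inr (q_start D)) h3 isT.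
    by move=> [[w [i b]] [[] k]].
  exists (n1 + v + 1 + v.+1), c4; split=> //; first by lia.
  by do 2 (apply: reach_trans; last by eassumption); apply: reach_trans r1 r2.
Qed.

(** One more query is asked after the last bit. Whatever its answer, the comparison finds no input
    bit and rejects. *)
Lemma prefix_end c x :
  represents c (st PUp) 0 (ptape x (size x) (counter (size x))) [::] ->
  exists n c', [/\ n <= 10 * (size x).+1, reach n c c' & c_state c' = inl PRej].
Proof.
set v := size x => h; have hs := size_counter v.
have [n1 [c1 [hn1 r1 h1]]] := query_counter h.
set y := X _ in h1.
have ns : ~~ special (st (if y then PYes else PNo)) by case: (y).
have [|c2 r2 h2] := represents_skip_right (d := v) X h1 ns.
  by move=> i hi; rewrite /=; case: (y) => /=; rewrite ifT //; lia.
have [c3 r3 h3] : exists2 c3, reach 1 c2 c3 & c_state c3 = inl PRej.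
  have := represents_trans X h2 ns; rewrite add0n /=.
  by case: (y); rewrite /= ltnn cell_of_ge // => /(_ isT)[c3 r3 [h3 _ _ _ _]]; exists c3.
exists (n1 + v + 1), c3; split=> //; first by lia.
by apply: reach_trans r3; apply: reach_trans r1 r2.
Qed.

(** Only the layer of [D] is compared, each side of the head up to trailing blanks: [D] may move
    left of its starting cell, which the one-way description [represents] does not cover. *)
Definition simulates (c : config pmachine) (d : config D) :=
  [/\ c_state c = inr (c_state d), (c_head c).1.1 = c_head d,
      forall i, (nth (blank pmachine) (c_left c) i).1.1 = nth (blank D) (c_left d) i &
      forall i, (nth (blank pmachine) (c_right c) i).1.1 = nth (blank D) (c_right d) i].

Lemma move_tapeE (M : OTM) l a r m : move_tape (M := M) l a r m =
  match m with
  | Stay => (l, a, r)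
  | MoveL => (behead l, head (blank M) l, a :: r)
  | MoveR => (a :: l, head (blank M) r, behead r)
  end.
Proof. by case: m; case: l; case: r. Qed.

Lemma simulates_step c d : simulates c d -> ~~ halted d ->
  simulates (step pmachine X c) (step D empty_oracle d).
Proof.
case: c d => [q l h r w] [q' l' h' r' w'] [/= -> hh hl hr] nh.
rewrite /step /= (negbTE nh); move: nh; rewrite /halted /= negb_or => /andP[/negbTE na /negbTE nr].
case: h hh => [[a [i vis]] [f k]] /= ->; rewrite na nr.
case: ifP => _; first by split.
case: (trans _ _ _) => [[[q1 b] m] k0]; rewrite !move_tapeE.
case: m; split=> //=; try by case.
- by have := hl 0; rewrite !nth0.
- by move=> j; rewrite !nth_behead.
- by have := hr 0; rewrite !nth0.
- by move=> j; rewrite !nth_behead.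
Qed.

Lemma simulates_halted c d : simulates c d -> halted d ->
  c_state (step pmachine X c) =
    inl (if c_state d == q_acc D then PAcc else PRej) :> pstate.
Proof.
case: c d => [q l h r w] [q' l' h' r' w'] [/= -> hh hl hr].
rewrite /halted /step /=; case: h hh => [[a [i vis]] [f k]] /= ->.
case e : (_ == q_acc D) => //=.
by case er : (_ == q_rej D) => //= _; rewrite ?e ?er.
Qed.

Lemma simulates_run t c d : simulates c d -> halted (iter t (step D empty_oracle) d) ->
  exists n c', reach n c c' /\ c_state c' =
    inl (if c_state (iter t (step D empty_oracle) d) == q_acc D then PAcc else PRej) :> pstate.
Proof.
elim: t c d => [|t IH] c d h ht.
  by exists 1, (step pmachine X c); split; last exact: simulates_halted.
have [hd|nd] := boolP (halted d).
  rewrite iter_step_halted //.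
  by exists 1, (step pmachine X c); split; last exact: simulates_halted.
move: ht; rewrite iterSr => ht.
have [n [c' [r e]]] := IH _ _ (simulates_step h nd) ht.
by exists n.+1, c'; split=> //; apply: etrans (iterSr _ _ _) r.
Qed.

Lemma simulates_start c x v l :
  represents c (inr (q_start D) : state pmachine) 0 (ptape x v l) [::] ->
  simulates c (init D x).
Proof.
case=> [h1 h2 h3 h4 _].
have [k1 k2 k3 k4 _] := represents_init D x.
split; rewrite ?h1 ?h2 ?h3 ?k1 ?k2 ?k3 //.
- by move=> i; rewrite !nth_nil.
- by move=> i; rewrite h4 k4.
Qed.

(** Once a mismatch has started [D] the second alternative persists through the remaining rounds. A
    time bound is claimed only while all bits agree, [D] being slow. *)
Lemma prefix_rounds x v : v <= size x ->
  exists n c, reach n (init pmachine x) c /\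
    ([/\ n <= 1 + v * (10 * (size x).+1), forall i, i < v -> X i = nth false x i &
       represents c (st PUp) 0 (ptape x v (counter v)) [::]] \/
     ~ is_prefix x X /\ simulates c (init D x)).
Proof.
elim: v => [|v IH] hv.
  have [c r h] := prefix_init x; exists 1, c; split=> //; left; split=> //.
have [n [c [r [[hn hp h]|h]]]] := IH (ltnW hv); last by exists n, c; split=> //; right.
have [n' [c' [hn' r' h']]] := prefix_round h hv.
exists (n + n'), c'; split; first exact: reach_trans r r'.
move: h'; case: eqP => e h'; last first.
  by right; split; [move/(_ v hv) | apply: simulates_start h'].
left; split=> //.
- have : 10 * v.+1 <= 10 * (size x).+1 by lia.
  by rewrite mulSn; lia.
- by move=> i; rewrite ltnS leq_eqVlt => /predU1P[->|/hp].
Qed.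

Lemma pmachine_prefix x : is_prefix x X ->
  c_state (run pmachine X x (1 + (size x).+1 * (10 * (size x).+1))) = inl PRej.
Proof.
move=> hx; have [n [c [r [[hn _ h]|[/(_ hx)[] //]]]]] := prefix_rounds (leqnn (size x)).
have [n' [c' [hn' r' e]]] := prefix_end h.
have rr := reach_trans r r'.
rewrite (@run_halted_le _ _ _ (n + n')); first by rewrite /run rr.
  by rewrite mulSn; lia.
by rewrite /run rr /halted e.
Qed.

Lemma pmachine_nonprefix x t : ~ is_prefix x X -> halted (run D empty_oracle x t) ->
  exists n, c_state (run pmachine X x n) =
    inl (if c_state (run D empty_oracle x t) == q_acc D then PAcc else PRej).
Proof.
move=> hx ht; have [n [c [r [[_ hp _]|[_ h]]]]] := prefix_rounds (leqnn (size x)).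
  by case: hx.
have [n' [c' [r' e]]] := simulates_run h ht.
by exists (n + n'); rewrite /run (reach_trans r r').
Qed.

End PrefixMachine.

(** * Strings and their codes *)

Fixpoint bits (n c : nat) : seq bool :=
  if n is m.+1 then rcons (bits m c./2) (odd c) else [::].

Lemma size_bits n c : size (bits n c) = n.
Proof. by elim: n c => //= n IH c; rewrite size_rcons IH. Qed.

Lemma codeK x : bits (size x) (code x) = x.
Proof.
elim/last_ind: x => // x b IH; rewrite size_rcons code_rcons /=.
by rewrite oddD odd_double oddb halfD odd_double /= doubleK; case: b; rewrite addn0 IH.
Qed.

Lemma bitsK n c : 2 ^ n <= c < 2 ^ n.+1 -> code (bits n c) = c.
Proof.
elim: n c => [|n IH] c hc /=; first by rewrite /code /bin_val /=; lia.
rewrite code_rcons IH; first by rewrite addnC odd_double_half.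
have := odd_double_half c; move: hc; rewrite !expnS; case: (odd c) => /=; lia.
Qed.

Lemma code_bounds x : 2 ^ size x <= code x < 2 ^ (size x).+1.
Proof.
elim/last_ind: x => // x b; rewrite size_rcons code_rcons !expnS.
by case: b => /=; lia.
Qed.

Lemma log_code x : trunc_log 2 (code x) = size x.
Proof. by apply: trunc_log_eq => //; apply: code_bounds. Qed.

Lemma code_inj : injective code.
Proof. by move=> x y e; rewrite -(codeK x) -(codeK y) -!log_code e. Qed.

Lemma take_bits i m c : i <= m -> take i (bits m c) = bits i (c %/ 2 ^ (m - i)).
Proof.
move=> /subnK<-; rewrite addnK; elim: (m - i) c => [|d IH] c.
  by rewrite divn1 take_oversize // size_bits.
rewrite /= -cats1 takel_cat ?size_bits ?leq_addl // IH.
by rewrite expnS divnMA divn2.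
Qed.

(** Shifts [a] by the length of the second string and adds [b] without its leading 1. *)
Definition cat_code a b := a * 2 ^ trunc_log 2 b + (b - 2 ^ trunc_log 2 b).

Lemma code_cat s t : code (s ++ t) = cat_code (code s) (code t).
Proof.
rewrite /cat_code log_code; elim/last_ind: t => [|t b IH].
  by rewrite cats0 muln1 addn0.
rewrite -rcons_cat !code_rcons IH size_rcons expnS.
have := code_bounds t; lia.
Qed.

(** In binary this is [n.+1] ones followed by a zero: the unary code of [n] behind a leading 1. *)
Definition enc_code n := 2 ^ n.+2 - 2.

Lemma code_enc_nat n : code (enc_nat n) = enc_code n.
Proof.
rewrite /enc_nat /enc_code code_rcons addn0.
suff -> : code (nseq n true) = 2 ^ n.+1 - 1 by rewrite [2 ^ n.+2]expnS; lia.
elim: n => // n IH; rewrite -addn1 nseqD cats1 code_rcons IH addn1 [2 ^ n.+2]expnS /=.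
by have := expn_gt0 2 n.+1; lia.
Qed.

(** * The diagonal language *)

Definition diag_lang (N : nat) (x : seq bool) : bool :=
  (N < size x) && (diag (size x) == code x).

Ltac prim_user ::= first
  [ apply: prim_nthn | apply: prim_pair | apply: prim_fst | apply: prim_snd | apply: prim_div
  | apply: prim_odd | apply: prim_log | apply: prim_diag ].

Lemma computable_ext (L L' : language) : (forall x, L x <-> L' x) -> computable L -> computable L'.
Proof.
move=> h [M hM]; exists M => x; have [t [h1 h2]] := hM x; exists t; split=> //.
by rewrite h2.
Qed.

Lemma computable_diag_lang N : computable (diag_lang N).
Proof.
pose P c := (N < trunc_log 2 c) && (diag (trunc_log 2 c) == c).
have h : prim_rec (fun v => P (nth 0 v 0)) by rewrite /P; prim.
by apply: computable_ext (prim_rec_computable h) => x; rewrite /P log_code.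
Qed.

Lemma run_halted_eq M X x t u : halted (run M X x t) -> halted (run M X x u) ->
  run M X x t = run M X x u.
Proof.
move=> ht hu; case/orP: (leq_total t u) => h.
- by rewrite (run_halted_le h ht).
- by rewrite (run_halted_le h hu).
Qed.

Lemma peval_mono p m n : m <= n -> peval p m <= peval p n.
Proof. by move=> h; elim: p => //= a p IH; rewrite leq_add2l leq_mul. Qed.

(** A single power is wanted because the candidates run for [n ^ sndn n] steps. Each Horner step
    raises the exponent by the coefficient plus 2: both summands are at most [n ^ m.+1], and their
    sum is at most [2 * n ^ m.+1]. *)
Lemma peval_bound p n : 1 < n -> peval p n <= n ^ (sumn p + (size p).*2).
Proof.
move=> n1; elim: p => //= a p IH.
have n0 : 0 < n by apply: ltnW.
set k := sumn p + _ in IH; set m := a + k.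
have -> : a + sumn p + (size p).+1.*2 = m.+2 by rewrite /m /k; lia.
have h1 : a <= n ^ m.+1.
  apply: leq_trans (ltnW (ltn_expl a n1)) _; rewrite leq_pexp2l // /m; lia.
have h2 : n * peval p n <= n ^ m.+1.
  by rewrite expnS leq_mul // (leq_trans IH) // leq_pexp2l // /m leq_addl.
apply: leq_trans (leq_add h1 h2) _; rewrite addnn -mul2n [n ^ m.+2]expnS.
by rewrite leq_mul.
Qed.

(** From [n.+1 <= n ^ 2] twice and [10 <= 2 ^ 4 <= n ^ 4] the product is at most [n ^ 8]; one more
    factor absorbs the 1. *)
Lemma prefix_time_bound n : 1 < n -> 1 + n.+1 * (10 * n.+1) <= n ^ 9.
Proof.
move=> n1; have h1 : n.+1 <= n ^ 2 by rewrite expnS expn1; nia.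
have h2 : 2 ^ 4 <= n ^ 4 by rewrite leq_exp2r.
have h3 : n.+1 * (10 * n.+1) <= n ^ 8.
  have -> : n ^ 8 = n ^ 2 * (n ^ 4 * n ^ 2) by rewrite -!expnD.
  by rewrite !leq_mul // (leq_trans _ h2).
have h4 : n ^ 9 = n * n ^ 8 by rewrite -expnS.
have := expn_gt0 n 8; nia.
Qed.

Lemma is_prefixP x A : is_prefix x A <-> x = mkseq A (size x).
Proof.
split=> h; last by move=> i hi; rewrite h nth_mkseq.
apply: (@eq_from_nth _ false); first by rewrite size_mkseq.
by move=> i hi; rewrite nth_mkseq // h.
Qed.

(* [M'] rejects the prefix of [A] of length [n] in time polynomial in [n], so at a length where
   [M'] is the candidate the search succeeds and [M'] errs on the string found. *)
Lemma low_for_speed_diag A N : low_for_speed A ->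
  exists2 n, N < n & diag n = code (mkseq A n).
Proof.
move=> lfs; apply: NNPP => hno.
(* By the assumption made for contradiction, rejecting every prefix of [A] outright is correct. *)
have hA x : is_prefix x A -> ~~ diag_lang N x.
  move=> /is_prefixP hx; apply/negP => /andP[hN /eqP e].
  by apply: hno; exists (size x); rewrite // -hx.
have [D hD] := computable_diag_lang N.
set T := fun n => 1 + n.+1 * (10 * n.+1).
have hP x : is_prefix x A -> c_state (run (pmachine D) A x (T (size x))) = inl PRej.
  exact: pmachine_prefix.
have hrun x : exists t, c_state (run (pmachine D) A x t) =
    inl (if diag_lang N x then PAcc else PRej).
  have [hx|hx] := classic (is_prefix x A).
    by exists (T (size x)); rewrite hP // (negbTE (hA _ hx)).
  have [t [h1 h2]] := hD x; have [n hn] := pmachine_nonprefix hx h1.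
  exists n; rewrite hn; congr (inl _); case: eqP => [/h2 -> //|ne].
  by case: ifP => // /h2.
have hhalt x : exists t, halted (run (pmachine D) A x t).
  by have [t e] := hrun x; exists t; rewrite /halted e; case: ifP.
(* The least halting time: at most [T] on prefixes of [A], and elsewhere whatever [D] requires. *)
pose f x := ex_minn (hhalt x).
have hf x : halted (run (pmachine D) A x (f x)) by rewrite /f; case: ex_minnP.
have hfT x : is_prefix x A -> f x <= T (size x).
  move=> hx; rewrite /f; case: ex_minnP => m _; apply.
  by rewrite /halted hP.
have [|M' [p hM']] := lfs _ (computable_diag_lang N) (pmachine D) f.
  move=> x; split=> //; have [t e] := hrun x.
  rewrite (@run_halted_eq _ _ _ (f x) t) ?hf //; last by rewrite /halted e; case: ifP.
  by rewrite e; case: ifP.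
set i := machine_code M'.
pose K := sumn p + (size p).*2.
(* [(n ^ 9) ^ K] bounds [p] at the quadratic time [T n]. The summands [N] and 2 yield [N < n] and
   [1 < n], because [n = pairn i j] exceeds [j]. *)
pose j := 9 * K + N + 2.
pose n := pairn i j.
have hjn : j < n.
  apply: leq_trans (ltn_expl j (isT : 1 < 3)) _.
  by rewrite /n /pairn leq_pmull // expn_gt0.
have n1 : 1 < n by apply: leq_trans hjn; rewrite /j; lia.
have hN : N < n by apply: ltn_trans hjn; rewrite /j; lia.
have n0 : 0 < n by apply: ltnW.
pose x0 := mkseq A n.
have sx0 : size x0 = n by rewrite size_mkseq.
have px0 : is_prefix x0 A by apply/is_prefixP; rewrite sx0.
have hfx0 : peval p (f x0) <= n ^ j.
  apply: leq_trans (peval_mono p (hfT _ px0)) _; rewrite sx0.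
  apply: leq_trans (peval_mono p (prefix_time_bound n1)) _.
  apply: leq_trans (peval_bound _ _) _.
    by apply: leq_trans n1 _; rewrite -{1}(expn1 n) leq_pexp2l.
  rewrite -expnM leq_pexp2l // /j -/K; lia.
have [h0 h0'] := hM' x0.
have nacc : c_state (run M' empty_oracle x0 (n ^ j)) <> q_acc M'.
  by rewrite (run_halted_le hfx0 h0) => /h0'; apply/negP; apply: hA.
have rej0 : c_state (run M' empty_oracle x0 (n ^ j)) = q_rej M'.
  have : halted (run M' empty_oracle x0 (n ^ j)) by rewrite (run_halted_le hfx0 h0).
  by case/orP => /eqP.
have rejE x : size x = n -> rejects n (code x) =
    (c_state (run M' empty_oracle x (n ^ j)) == q_rej M').
  move=> sx; rewrite /rejects /n fst_pairn snd_pairn -/n -sx simP sx.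
  rewrite /rej_field /i /machine_code !(fst_pairn, snd_pairn).
  by rewrite (inj_eq (@state_code_inj M')).
have := diagP n; case: eqP => [_ /(_ (code x0))|_ [hd hr]].
  by rewrite -{1 2}sx0 code_bounds rejE // rej0 eqxx => /(_ isT).
pose x1 := bits n (diag n).
have sx1 : size x1 = n by rewrite size_bits.
have cx1 : code x1 = diag n by rewrite bitsK.
move: hr; rewrite -cx1 rejE // => /eqP rej1.
have [h1 h1'] := hM' x1.
have acc1 : c_state (run M' empty_oracle x1 (peval p (f x1))) = q_acc M'.
  by apply/h1'; rewrite /diag_lang sx1 hN cx1 eqxx.
(* The two times are not compared, and [peval p (f x1)] may be huge: halted configurations no longer
   change, so both runs end in the same one. *)
have e : run M' empty_oracle x1 (n ^ j) = run M' empty_oracle x1 (peval p (f x1)).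
  by apply: run_halted_eq => //; rewrite /halted rej1 eqxx orbT.
(* A machine may have equal accepting and rejecting states. By [e] those of [M'] coincide, so the
   rejection of [x0] would be an acceptance, against [nacc]. *)
by apply: nacc; rewrite rej0 -rej1 e acc1.
Qed.

(** * The Schnorr test *)

Definition diag_string n : option (seq bool) :=
  if diag n == 0 then None else Some (bits n (diag n)).

Definition test (n i : nat) : option (seq bool) :=
  if n < i then diag_string i else None.

(* If [c] codes a string of length [m], then [c %/ 2 ^ (m - i)] codes its prefix of length [i]. *)
Definition hit n N m c := has (fun i => diag i == c %/ 2 ^ (m - i)) (iota n.+1 (N - n.+1)).

(** The measure of a stage scaled by [2 ^ m]: the range runs over the codes of all strings of length
    [m]. *)
Definition hits n N m := count (hit n N m) (iota (2 ^ m) (2 ^ m)).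

Lemma diag_bounds i : diag i != 0 -> 2 ^ i <= diag i < 2 ^ i.+1.
Proof. by move=> h; have := diagP i; rewrite (negbTE h) => -[]. Qed.

Lemma code_diag_bits i : diag i != 0 -> code (bits i (diag i)) = diag i.
Proof. by move=> h; rewrite bitsK // diag_bounds. Qed.

(** Division by [D] is constant on each block of [D] consecutive numbers starting at a multiple of
    [D]. *)
Lemma count_div (P : pred nat) D a b : 0 < D ->
  count (fun c => P (c %/ D)) (iota (a * D) (b * D)) = count P (iota a b) * D.
Proof.
move=> D0; elim: b => [|b IH]; first by rewrite mul0n.
rewrite mulSn addnC iotaD count_cat IH -addn1 iotaD count_cat mulnDl; congr (_ + _).
rewrite -mulnDl /= addn0.
have : forall c, c \in iota ((a + b) * D) D -> P (c %/ D) = P (a + b).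
  move=> c; rewrite mem_iota => /andP[h1 h2]; congr P.
  by rewrite -(subnKC h1) divnMDl // divn_small ?addn0 //; lia.
move/eq_in_count ->; case: (P _); first by rewrite count_predT size_iota mul1n.
by rewrite count_pred0.
Qed.

(** Each string of length [m] has [2 ^ d] extensions, which contain the same diagonal strings as
    prefixes when these have length at most [m]. A length with [diag i = 0] may exceed [m]: the
    quotient of [c] is never 0, so it gives no hit at either level. *)
Lemma hits_level n N m d : (forall i, n < i < N -> diag i != 0 -> i <= m) ->
  hits n N (m + d) = hits n N m * 2 ^ d.
Proof.
move=> h; rewrite /hits expnD -count_div ?expn_gt0 //.
apply: eq_in_count => c; rewrite mem_iota -expnD => hc.
apply: eq_in_has => i; rewrite mem_iota => hi.
have [e|ne] := eqVneq (diag i) 0; last first.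
  have him : i <= m by apply: h => //; lia.
  by rewrite -divnMA -expnD addnC addnBA // addnC.
have q0 (u v : nat) : u %/ 2 ^ v == 0 -> u < 2 ^ v.
  by rewrite -leqn0 -ltnS ltn_divLR ?expn_gt0 // mul1n.
rewrite e ![0 == _]eq_sym; apply/idP/idP => /q0 hlt; exfalso; move: hc hlt.
  have : 2 ^ (m + d - i) <= 2 ^ (m + d) by rewrite leq_exp2l // leq_subr.
  by lia.
rewrite ltn_divLR ?expn_gt0 // -expnD.
have : 2 ^ (m - i + d) <= 2 ^ (m + d) by rewrite leq_exp2l // leq_add2r leq_subr.
by lia.
Qed.

Lemma hits_bound n N m : N <= m.+1 -> hits n N m * 2 ^ n <= 2 ^ m.
Proof.
move=> hN; have [le|lt] := leqP N n.+1.
  rewrite /hits /hit (eqP (_ : N - n.+1 == 0)) ?subn_eq0 //=.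
  by rewrite (eq_count (a2 := pred0)) ?count_pred0.
(* There is at most one diagonal string of length [i], and it has [2 ^ (m - i)] extensions of length
   [m]. *)
have single i : i <= m ->
    count (fun c => diag i == c %/ 2 ^ (m - i)) (iota (2 ^ m) (2 ^ m)) <= 2 ^ (m - i).
  move=> hi; rewrite -{2 3}(subnKC hi) expnD (count_div (fun q => diag i == q)) ?expn_gt0 //.
  rewrite -{2}[2 ^ (m - i)]mul1n leq_mul2r; apply/orP; right.
  rewrite (eq_count (a2 := pred1 (diag i))) => [|q]; last exact: eq_sym.
  by rewrite count_uniq_mem ?iota_uniq // leq_b1.
(* The geometric sum in telescoped form: the added term is what the lengths still to come may use,
   and each length takes half of it. *)
suff h k : n + k <= m -> hits n (n.+1 + k) m + 2 ^ (m - (n + k)) <= 2 ^ (m - n).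
  have := h (N - n.+1); rewrite subnKC ?(ltnW lt) // => /(_ _)/(leq_trans (leq_addr _ _)) h'.
  have hnm : n <= m by lia.
  rewrite -[in X in _ <= X](subnK hnm) expnD leq_mul2r h' ?orbT //; lia.
elim: k => [|k IH] hk.
  rewrite addn0 /hits /hit subnn /= (eq_count (a2 := pred0)) // count_pred0 !addn0.
  exact: leqnn.
have {}IH := IH (ltnW (leq_trans (_ : n + k < n + k.+1) hk)).
have hs : hits n (n.+1 + k.+1) m <= hits n (n.+1 + k) m + 2 ^ (m - (n.+1 + k)).
  apply: leq_trans (leq_add (leqnn _) (single (n.+1 + k) _)); last by lia.
  rewrite /hits -count_predUI; apply: leq_trans (leq_addr _ _).
  apply: sub_count => c /hasP[i]; rewrite mem_iota => hi e /=.
  have [ei|ne] := eqVneq i (n.+1 + k); apply/orP; [by right; rewrite -ei | left].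
  by apply/hasP; exists i => //; rewrite mem_iota; lia.
have e : 2 ^ (m - (n + k)) = 2 * 2 ^ (m - (n + k.+1)).
  by rewrite -expnS; congr (2 ^ _); lia.
move: hs IH; rewrite e (_ : n.+1 + k = n + k.+1); last by lia.
lia.
Qed.

(** Cutting the lengths at [k] isolates the tail, to which [hits_bound] applies with [k] in place of
    [n]. *)
Lemma hits_split n k N m : hits n N m <= hits n k.+1 m + hits k N m.
Proof.
rewrite /hits -count_predUI; apply: leq_trans (leq_addr _ _).
apply: sub_count => c /hasP[i]; rewrite mem_iota => hi e /=.
case: (leqP i k) => hk; apply/orP; [left | right]; apply/hasP; exists i => //.
- by rewrite mem_iota; lia.
- by rewrite mem_iota; lia.
Qed.

(** Turns the cardinality in [measure_fin] into a count over an interval of codes, which is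
    primitive recursive when the predicate is. *)
Lemma card_tuples L (Q : pred (seq bool)) :
  #|[set t : L.-tuple bool | Q t]| = count (fun c => Q (bits L c)) (iota (2 ^ L) (2 ^ L)).
Proof.
have bitsT (t : L.-tuple bool) : bits L (code t) = t.
  by have := codeK t; rewrite size_tuple.
rewrite cardE -(size_map val) -size_filter -(size_map (bits L)).
apply: perm_size; apply: uniq_perm.
- by rewrite map_inj_uniq ?enum_uniq //; apply: val_inj.
- rewrite map_inj_in_uniq ?filter_uniq ?iota_uniq // => c d.
  rewrite !mem_filter !mem_iota addnn -mul2n -expnS => /andP[_ hc] /andP[_ hd] e.
  by rewrite -(bitsK hc) -(bitsK hd) e.
move=> x; apply/mapP/mapP => -[].
- move=> t; rewrite mem_enum inE => hQ ->; exists (code t).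
    rewrite mem_filter mem_iota addnn -mul2n -expnS bitsT hQ /=.
    by have := code_bounds t; rewrite size_tuple.
  by rewrite bitsT.
- move=> c; rewrite mem_filter mem_iota => /andP[hQ hc] ->.
  have hs : size (bits L c) == L by rewrite size_bits.
  by exists (Tuple hs) => //; rewrite mem_enum inE.
Qed.

Lemma prefix_bits i L c : diag i != 0 -> i <= L -> 2 ^ L <= c < 2 ^ L.+1 ->
  prefix (bits i (diag i)) (bits L c) = (diag i == c %/ 2 ^ (L - i)).
Proof.
move=> hd hi hc; rewrite prefixE size_bits take_bits // eq_sym.
apply/eqP/eqP => [|-> //] e.
rewrite -[LHS]code_diag_bits // e bitsK //.
rewrite leq_divRL ?expn_gt0 // ltn_divLR ?expn_gt0 // -!expnD addSn.
by rewrite subnKC.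
Qed.

Lemma mem_stage n N s :
  (s \in pmap id [seq test n i | i <- iota 0 N]) =
  has (fun i => (diag i != 0) && (s == bits i (diag i))) (iota n.+1 (N - n.+1)).
Proof.
rewrite mem_pmap map_id; apply/mapP/hasP.
- move=> [i]; rewrite mem_iota /test /diag_string => hi.
  case: ifP => // ni; case: eqP => // /eqP d0 [->].
  by exists i; rewrite ?d0 ?eqxx // mem_iota; lia.
- move=> [i]; rewrite mem_iota => hi /andP[d0 /eqP->]; exists i.
    by rewrite mem_iota; lia.
  by rewrite /test /diag_string (negbTE d0) ifT //; lia.
Qed.

Local Open Scope ring_scope.

Lemma dyad_gt0 n : 0 < dyad n.
Proof. by rewrite invr_gt0 exprn_gt0. Qed.

Lemma dyad_le a m b n : (a * 2 ^ n <= b * 2 ^ m)%N -> a%:R * dyad m <= b%:R * dyad n.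
Proof.
move=> h; rewrite /dyad ler_pdivrMr ?exprn_gt0 // mulrAC ler_pdivlMr ?exprn_gt0 //.
by rewrite -!natrX -!natrM ler_nat.
Qed.

(** [measure_fin] counts at the length of the longest string present, which may be smaller than
    [N.-1] as some lengths receive no string. [hits_level] moves the count to any level [m] that
    bounds all lengths of the stage. *)
Lemma stage_measureE n N m : (N <= m.+1)%N ->
  stage_measure test n N = (hits n N m)%:R * dyad m.
Proof.
move=> hN; rewrite /stage_measure /measure_fin.
set S := pmap _ _; set L := \max_(s <- S) size s.
have hSL i : (n < i < N)%N -> diag i != 0%N -> (i <= L)%N.
  move=> hi d0; rewrite -(size_bits i (diag i)) /L.
  apply: (@leq_bigmax_seq _ S predT size) => //.
  rewrite mem_stage; apply/hasP; exists i; last by rewrite d0 eqxx.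
  by rewrite mem_iota; lia.
have hLm : (L <= m)%N.
  apply/bigmax_leqP_seq => s hs _; move: hs; rewrite mem_stage => /hasP[i].
  by rewrite mem_iota => hi /andP[_ /eqP->]; rewrite size_bits; lia.
rewrite (card_tuples L (fun t : seq bool => has (fun s => prefix s t) S)).
have -> : count (fun c => has (fun s => prefix s (bits L c)) S) (iota (2 ^ L) (2 ^ L)) = hits n N L.
  apply: eq_in_count => c; rewrite mem_iota addnn -mul2n -expnS => hc.
  apply/hasP/hasP.
  - move=> [s]; rewrite mem_stage => /hasP[i hi /andP[d0 /eqP->]] hp.
    exists i => //; rewrite -prefix_bits // hSL //.
    by move: hi; rewrite mem_iota; lia.
  - move=> [i hi e].
    have d0 : diag i != 0%N.
      apply/eqP => d0; move: e; rewrite d0 eq_sym -leqn0 -ltnS ltn_divLR ?expn_gt0 // mul1n.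
      have : (2 ^ (L - i) <= 2 ^ L)%N by rewrite leq_exp2l // leq_subr.
      by lia.
    exists (bits i (diag i)).
      by rewrite mem_stage; apply/hasP; exists i; rewrite ?d0 ?eqxx.
    rewrite prefix_bits // hSL //.
    by move: hi; rewrite mem_iota; lia.
rewrite -(subnKC hLm) hits_level //.
by apply/eqP; rewrite eq_le; apply/andP; split; apply: dyad_le; rewrite -?mulnA -expnD addnC.
Qed.

Lemma stage_measure_le n N : stage_measure test n N <= dyad n.
Proof.
rewrite (stage_measureE n (leqnSn N)) -[dyad n]mul1r; apply: (@dyad_le _ _ 1).
by rewrite mul1n hits_bound.
Qed.

(** Lengths up to [k] are counted exactly, and the longer ones weigh at most 2^-k. This computable
    tail is what makes the test a Schnorr test. *)
Lemma stage_measure_upper n k N :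
  stage_measure test n N <= (hits n k.+1 k)%:R * dyad k + dyad k.
Proof.
set m := maxn N k; have hN : (N <= m.+1)%N by rewrite /m; lia.
rewrite (stage_measureE n hN) -{2}[dyad k]mul1r -mulrDl natr1; apply: dyad_le.
have hk : (k + (m - k) = m)%N by rewrite /m; lia.
have h1 : hits n k.+1 m = (hits n k.+1 k * 2 ^ (m - k))%N.
  by rewrite -{1}hk hits_level // => i; lia.
have h2 := hits_bound k hN.
apply: leq_trans (leq_mul (hits_split n k N m) (leqnn _)) _.
by rewrite mulnDl h1 mulSn addnC -mulnA -expnD [(m - k + k)%N]addnC hk leq_add.
Qed.

Lemma stage_measure_lower n k :
  (hits n k.+1 k)%:R * dyad k - dyad k <= stage_measure test n k.+1.
Proof.
rewrite (stage_measureE n (leqnn k.+1)) gerBl; exact: ltW (dyad_gt0 k).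
Qed.

Local Close Scope ring_scope.

(** * Computability of the test and of its measures *)

Definition graph_test (F : nat -> nat -> nat) (c : nat) : bool :=
  has (fun n => has (fun i =>
    cat_code (enc_code n) (cat_code (enc_code i) (F n i)) == c) (iota 0 c)) (iota 0 c).

Lemma prim_cat_code f g : prim_rec f -> prim_rec g ->
  prim_rec (fun v => cat_code (f v) (g v)).
Proof. by move=> hf hg; rewrite /cat_code; prim. Qed.

Lemma prim_enc_code f : prim_rec f -> prim_rec (fun v => enc_code (f v)).
Proof. by move=> hf; rewrite /enc_code; prim. Qed.

Lemma prim_graph_test F : prim_rec (fun v => F (nth 0 v 0) (nth 0 v 1)) ->
  prim_rec (fun v => graph_test F (nth 0 v 0) : nat).
Proof.
move=> hF.
have h : prim_rec (fun v => has (fun i => cat_code (enc_code (nth 0 v 0))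
    (cat_code (enc_code i) (F (nth 0 v 0) i)) == nth 0 v 1) (iota 0 (nth 0 v 1)) : nat).
  apply: (prim_has (P := fun i v => cat_code (enc_code (nth 0 v 0))
    (cat_code (enc_code i) (F (nth 0 v 0) i)) == nth 0 v 1)); last by prim.
  apply: prim_eq; last by prim.
  apply: prim_cat_code; first by apply: prim_enc_code; prim.
  apply: prim_cat_code; first by apply: prim_enc_code; prim.
  by apply: prim_app2 hF _ _; prim.
apply: (prim_has (P := fun n v => has (fun i => cat_code (enc_code n)
    (cat_code (enc_code i) (F n i)) == nth 0 v 0) (iota 0 (nth 0 v 0)))); last by prim.
apply: (prim_app2 (F := fun n c => has (fun i => cat_code (enc_code n)
    (cat_code (enc_code i) (F n i)) == c) (iota 0 c) : nat)) => //; by prim.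
Qed.

(** Unary encoding bounds the search: [n] and [i] are smaller than the length of [s], hence than its
    code. *)
Lemma computable_graph (G : nat -> nat -> seq bool) :
  prim_rec (fun v => code (G (nth 0 v 0) (nth 0 v 1))) ->
  computable (fun s => exists n i, s = enc_nat n ++ enc_nat i ++ G n i).
Proof.
move=> hG; have h := prim_graph_test (F := fun n i => code (G n i)) hG.
apply: computable_ext (prim_rec_computable h) => s; split.
- move=> /hasP[n _ /hasP[i _ /eqP]]; rewrite -!code_enc_nat -!code_cat => /code_inj e.
  by exists n, i.
- move=> [n [i e]].
  have hlt : size s < code s.
    by have := code_bounds s; have := ltn_expl (size s) (isT : 1 < 2); lia.
  have hs : n < size s /\ i < size s.
    by rewrite e !size_cat !size_rcons !size_nseq; lia.
  apply/hasP; exists n; first by rewrite mem_iota; lia.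
  apply/hasP; exists i; first by rewrite mem_iota; lia.
  by rewrite -!code_enc_nat -!code_cat e.
Qed.

Lemma computable_test : computable_fun_opt test.
Proof.
apply: computable_graph.
(* 3 and 2 are the codes of [[:: true]] and [[:: false]], the tags used by [enc_opt]. *)
apply: (@prim_ext (fun v => if (nth 0 v 0 < nth 0 v 1) && (diag (nth 0 v 1) != 0)
   then cat_code 3 (diag (nth 0 v 1)) else 2)).
  by apply: prim_if; try apply: prim_cat_code; prim.
move=> v; rewrite /test /diag_string; case: (_ < _) => //=.
case: eqP => //= /eqP d0.
by rewrite -{1}(code_diag_bits d0) -(code_cat [:: true]).
Qed.

Lemma count_iota (P : pred nat) a b : count P (iota a b) = \sum_(0 <= d < b) P (a + d).
Proof.
elim: b => [|b IH]; first by rewrite big_nil.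
by rewrite -addn1 iotaD count_cat IH addn1 big_nat_recr //= addn0.
Qed.

Lemma hitE n k c : hit n k.+1 k c =
  has (fun j => diag (n.+1 + j) == c %/ 2 ^ (k - (n.+1 + j))) (iota 0 (k - n)).
Proof.
rewrite /hit subSS.
have -> : iota n.+1 (k - n) = map (addn n.+1) (iota 0 (k - n)) by rewrite -iotaDl addn0.
by rewrite has_map.
Qed.

Lemma prim_hit f g h : prim_rec f -> prim_rec g -> prim_rec h ->
  prim_rec (fun v => hit (f v) (g v).+1 (g v) (h v) : nat).
Proof.
apply: (prim_app3 (F := fun n k c => hit n k.+1 k c : nat)).
apply: (@prim_ext (fun v => has (fun j => diag ((nth 0 v 0).+1 + j) ==
    nth 0 v 2 %/ 2 ^ (nth 0 v 1 - ((nth 0 v 0).+1 + j))) (iota 0 (nth 0 v 1 - nth 0 v 0)))).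
  apply: (prim_has (P := fun j v => diag ((nth 0 v 0).+1 + j) ==
    nth 0 v 2 %/ 2 ^ (nth 0 v 1 - ((nth 0 v 0).+1 + j)))); by prim.
by move=> v; rewrite hitE.
Qed.

Lemma computable_hits : computable_fun_nat (fun n k => hits n k.+1 k).
Proof.
apply: computable_graph.
apply: (@prim_ext (fun v => enc_code (\sum_(0 <= d < 2 ^ nth 0 v 1)
    hit (nth 0 v 0) (nth 0 v 1).+1 (nth 0 v 1) (2 ^ nth 0 v 1 + d)))).
  apply: prim_enc_code.
  apply: (prim_sum (F := fun d v => hit (nth 0 v 0) (nth 0 v 1).+1 (nth 0 v 1)
    (2 ^ nth 0 v 1 + d) : nat)); last by prim.
  by apply: prim_hit; prim.
by move=> v; rewrite code_enc_nat /hits count_iota.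
Qed.

Lemma schnorr_test_diag : schnorr_test test.
Proof.
split; first exact: computable_test.
split; first exact: stage_measure_le.
exists (fun n k => hits n k.+1 k); split; first exact: computable_hits.
move=> n k; split; first exact: stage_measure_upper.
by exists k.+1; apply: stage_measure_lower.
Qed.

(** * Low for speed oracles are caught by the diagonal strings *)

Lemma low_for_speed_prefix A N : low_for_speed A ->
  exists2 n, N < n & diag n != 0 /\ is_prefix (bits n (diag n)) A.
Proof.
move=> /(low_for_speed_diag N)[n hn e]; exists n => //.
have := code_bounds (mkseq A n); rewrite size_mkseq -e => hd; split.
  by have := expn_gt0 2 n; lia.
by apply/is_prefixP; apply: code_inj; rewrite size_bits bitsK.
Qed.

Lemma schnorr_random_not_low A : schnorr_random A -> ~ low_for_speed A.
Proof.
move=> hr hl; apply: (hr test schnorr_test_diag) => n.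
have [i hi [d0 hp]] := low_for_speed_prefix n hl.
by exists i, (bits i (diag i)); rewrite /test hi /diag_string (negbTE d0).
Qed.

Lemma sum_dyad_le k N : (\sum_(i < N) dyad (k.+1 + i) <= dyad k)%R.
Proof.
suff -> : (\sum_(i < N) dyad (k.+1 + i) = dyad k - dyad (k + N))%R.
  by rewrite gerBl ltW // dyad_gt0.
elim: N => [|N IH]; first by rewrite big_ord0 addn0 subrr.
rewrite big_ord_recr /= IH.
have e : (dyad (k + N) = dyad (k.+1 + N) + dyad (k.+1 + N))%R.
  by rewrite -mulr2n -[RHS]mulr_natl /dyad addSn exprS invfM mulrA divff // mul1r.
by rewrite e addSnnS opprD addrA subrK.
Qed.

Lemma null_set_low : null_set low_for_speed.
Proof.
(* One cylinder for each length above [k]. A length without a diagonal string contributes the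
   all-zero string, whose weight is already counted in the geometric sum. *)
move=> k; exists (fun i => bits (k.+1 + i) (diag (k.+1 + i))); split.
  move=> N; under eq_bigr do rewrite size_bits; exact: sum_dyad_le.
move=> X /(low_for_speed_prefix k)[n hn [_ hp]].
by exists (n - k.+1); rewrite subnKC.
Qed.

Theorem theorem4p1 :
  (forall A : oracle, schnorr_random A -> ~ low_for_speed A) /\ null_set low_for_speed.
Proof. by split; [apply: schnorr_random_not_low | apply: null_set_low]. Qed.
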